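(* For every $\epsilon>0$ there exists $\beta_0=\beta_0(\epsilon)>0$ such that the following holds. If $$\beta:=\sum_{p\ge 2}\sqrt{p^3\log p}\;\beta_p\le \beta_0,$$ then there exist constants $c,C>0$, independent of $N\in\mathbb{N}$, such that for every $N\in\mathbb{N}$ $$\mathbb{P}\big(a_{H_N}>1+\epsilon\big)\le C\exp(-cN).$$
   Context: Setting (mixed $p$-spin model). For $N\in\mathbb{N}$ let $\Sigma_N=\{-1,1\}^N$. Let $\beta_p\ge 0$ ($p\ge2$) be summable deterministic coefficients and $\eta_i\in\mathbb{R}$ ($i\in\mathbb{N}$) deterministic external fields. Let $g_{i_1\ldots i_p}$ ($p\ge 2$) be i.i.d. standard Gaussian random variables for all ordered tuples $(i_1,\ldots,i_p)\in\mathbb{N}^p$ with pairwise distinct entries (independent over all $p$ and all such tuples), and set $g_{i_1\ldots i_p}:=0$ whenever two of the indices coincide. The (random) Hamiltonian $H_N:\Sigma_N\to\mathbb{R}$ is $$H_N(\sigma)=\sum_{p\ge2}\frac{\beta_p}{N^{(p-1)/2}}\sum_{1\le i_1,\ldots,i_p\le N}g_{i_1\ldots i_p}\sigma_{i_1}\cdots\sigma_{i_p}+\sum_{1\le i\le N}\eta_i\sigma_i .$$ The Gibbs measure on $\Sigma_N$ is $\mu_N(\sigma)=e^{H_N(\sigma)}/\sum_{\tau\in\Sigma_N}e^{H_N(\tau)}$; $\langle f\rangle$ denotes expectation under $\mu_N$ and $\langle f;g\rangle=\langle fg\rangle-\langle f\rangle\langle g\rangle$ the covariance. For $f:\Sigma_N\to\mathbb{R}$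 and $1\le j\le N$ set $(\partial_jf)(\sigma)=\frac12\big(f(\sigma)-f(\hat\sigma_j)\big)$, where $\hat\sigma_j$ is $\sigma$ with its $j$-th coordinate multiplied by $-1$. The $j$-th cavity field is $B_j(\sigma)=\sigma_j\,\partial_jH_N(\sigma)$ (it does not depend on $\sigma_j$). The Dirichlet form is $$D(f)=\sum_{j=1}^N\big\langle\cosh^{-2}(B_j)(\partial_jf)^2\big\rangle,$$ and the inverse spectral gap is $$a_{H_N}=\sup_{f:\Sigma_N\to\mathbb{R},\ f\ne\mathrm{const}}\frac{\langle f;f\rangle}{D(f)} .$$ $\mathbb{P}$ is the probability over the Gaussian couplings. *)

(* Defs.v *)
From HB Require Import structures.
From mathcomp Require Import all_boot all_order all_algebra.
From mathcomp Require Import all_classical all_reals all_analysis.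

Set Implicit Arguments.
Unset Strict Implicit.
Unset Printing Implicit Defensive.

Import Order.TTheory GRing.Theory Num.Theory.
Import numFieldNormedType.Exports.

Local Open Scope classical_set_scope.
Local Open Scope ring_scope.

(* The cube Sigma_N = {-1, 1}^N, with coordinates numbered from 0: the boolean
   [true] stands for the spin -1 and [false] for +1. *)
Notation config N := {ffun 'I_N -> bool}.

Definition spin (R : realType) (N : nat) (s : config N) (i : 'I_N) : R :=
  (-1) ^+ s i.

Definition flip (N : nat) (j : 'I_N) (s : config N) : config N :=
  [ffun k => if k == j then ~~ s k else s k].

Definition cosh (R : realType) (x : R) : R := (expR x + expR (- x)) / 2.

(* [x] is a realization of the couplings, x [:: i_1; ...; i_p] being the value
   of g_(i_1 ... i_p). *)
Definition p_spin (R : realType) (x : seq nat -> R) (p N : nat)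
    (s : config N) : R :=
  \sum_(t : p.-tuple 'I_N)
    x [seq val i | i <- t] * \prod_(i <- t) spin R s i.

(* The series over p is a limit of partial sums. When x vanishes on tuples with
   a repeated entry, its terms are 0 for p > N, so the limit exists. *)
Definition hamiltonian (R : realType) (beta eta : nat -> R)
    (x : seq nat -> R) (N : nat) (s : config N) : R :=
  limn (fun n => \sum_(2 <= p < n)
    beta p / (N%:R `^ ((p%:R - 1) / 2)) * p_spin x p s)
  + \sum_(i < N) eta i * spin R s i.

Section gibbs.
Context (R : realType) (N : nat).
Implicit Types (H f g : config N -> R).

Definition gibbs H (s : config N) : R :=
  expR (H s) / \sum_(t : config N) expR (H t).

Definition mean H f : R := \sum_(s : config N) gibbs H s * f s.

Definition covar H f g : R :=
  mean H (fun s => f s * g s) - mean H f * mean H g.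

Definition pderiv (j : 'I_N) f (s : config N) : R := (f s - f (flip j s)) / 2.

Definition cavity H (j : 'I_N) (s : config N) : R :=
  spin R s j * pderiv j H s.

Definition dirichlet H f : R :=
  \sum_(j < N) mean H (fun s => cosh (cavity H j s) ^- 2 * pderiv j f s ^+ 2).

(* The denominator is positive for nonconstant f. *)
Definition inverse_gap H : \bar R :=
  ereal_sup [set (covar H f f / dirichlet H f)%:E
            | f in [set f : config N -> R | forall c, f <> cst c]].

End gibbs.

Section couplings.
Context d (T : measurableType d) (R : realType) (P : probability T R).

Definition mutually_independent (I : choiceType) (D : set I)
    (X : I -> {RV P >-> R}) :=
  forall (r : seq I) (A : I -> set R),
    uniq r -> [set` r] `<=` D -> (forall i, measurable (A i)) ->
    P (\bigcap_(i in [set` r]) (X i @^-1` A i)) =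
    (\prod_(i <- r) P (X i @^-1` A i))%E.

Definition standard_gaussian (X : {RV P >-> R}) :=
  forall A : set R, measurable A -> distribution P X A = normal_prob 0 1 A.

(* Tuples of indices are sequences of length p >= 2; the values of g on
   sequences of length 0 and 1 are irrelevant. *)
Definition gaussian_couplings (g : seq nat -> {RV P >-> R}) :=
  [/\ forall t, (2 <= size t)%N -> uniq t -> standard_gaussian (g t),
      mutually_independent [set t | (2 <= size t)%N && uniq t] g &
      forall t, (2 <= size t)%N -> ~~ uniq t -> forall w, g t w = 0].

End couplings.

(* Main.v *)
Require Import Defs.
From mathcomp Require Import all_boot all_order all_algebra.
From mathcomp Require Import all_classical all_reals all_analysis.
From mathcomp Require Import measurable_realfun ring lra.

(* Write t_i for (twice) the heat-bath flip rates, d_i for the discrete derivatives and L for the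
   generator - sum_i t_i d_i, so that D(f) = <- f L f>. The gap follows from the Bochner inequality
   <(L f)^2> >= (1 - O(kappa)) D(f). Expanding the left-hand side by detailed balance gives D(f),
   plus the nonnegative term sum_{i <> j} <t_i t_j (d_i d_j f)^2>, plus error terms governed by the
   Hessian J_ij = d_i d_j H, i <> j.

   The operator norm of J is of order sum_p p^2 beta_p at exceptional configurations, which the
   hypothesis does not control: this is due to the single direction (1, ..., 1) (in the gauge
   sigma = 1). Off that direction the Gaussian process x^T J y has variance at most
   N^-1 sum_p p^3 beta_p^2, because cross terms vanish when sum_i x_i = 0; a union bound over
   configurations and integer vectors then gives J = w 1 1^T + E with |E| <= kappa and
   w^2 N <= kappa^2 outside an event of probability O(exp(- N)).

   The contribution of w 1 1^T is handled by an integration by parts: the row averages of J are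
   the gradient of the potential Y = (sum_j d_j H - H) / N, so that sum_i t_i d_i Y equals
   w sum_i t_i up to O(kappa), while the gradient of Y has norm O(kappa). *)

(** The external fields are arbitrary, so a rate t_i may be arbitrarily small. An error term is
    affordable only if it carries the factor t_i of D(f) or t_i t_j of the second-order term. This
    is why the rates are estimated relative to themselves, as in |d_i t_j| <= 4 t_j |J_ij|.

    The leading constant 1 is the gap of independent spins: the diagonal terms of <(L f)^2> give
    D(f) exactly, whatever the interaction.

    Even with w = O(kappa / sqrt N), the flat term w (sum_i t_i d_i f) (sum_j t_j (2 - t_j) d_j f)
    is too large for Cauchy-Schwarz: the bound carries a factor w M, where M = 1 + sum_i t_i may be
    of order N. The product of the two sums divided by M, however, is O(energy), and its gradient is
    controlled by the energy and the second-order term. The integration by parts is therefore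
    applied to this quotient, and w M is what [potential] produces. *)

Set Implicit Arguments.
Unset Strict Implicit.
Unset Printing Implicit Defensive.

Import Order.TTheory GRing.Theory Num.Theory.
Import numFieldNormedType.Exports.

Local Open Scope classical_set_scope.
Local Open Scope ring_scope.

(** * Nearly flat symmetric matrices *)

Section finite_sums.
Context {R : realFieldType}.

Lemma cauchy_schwarz_sum (I : finType) (w a b : I -> R) :
  (forall i, 0 <= w i) ->
  (\sum_i w i * a i * b i) ^+ 2 <=
  (\sum_i w i * a i ^+ 2) * (\sum_i w i * b i ^+ 2).
Proof.
move=> w0.
have : 0 <= \sum_i \sum_j w i * w j * (a i * b j - a j * b i) ^+ 2.
  by apply: sumr_ge0 => i _; apply: sumr_ge0 => j _;
    rewrite mulr_ge0 ?sqr_ge0 ?mulr_ge0.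
rewrite (_ : \sum_i _ = 2 * ((\sum_i w i * a i ^+ 2) * (\sum_i w i * b i ^+ 2) -
    (\sum_i w i * a i * b i) ^+ 2)).
  by rewrite pmulr_rge0 ?subr_ge0// ltr0n.
transitivity (\sum_i \sum_j ((w i * a i ^+ 2) * (w j * b j ^+ 2) +
   (w i * b i ^+ 2) * (w j * a j ^+ 2) - 2 * ((w i * a i * b i) * (w j * a j * b j)))).
  by apply: eq_bigr => i _; apply: eq_bigr => j _; ring.
under eq_bigr do rewrite sumrB big_split /= -!mulr_sumr.
rewrite sumrB big_split /= -!mulr_suml -mulr_sumr -mulr_suml; ring.
Qed.

Lemma cauchy_schwarz_sum1 (I : finType) (w a : I -> R) :
  (forall i, 0 <= w i) ->
  (\sum_i w i * a i) ^+ 2 <= (\sum_i w i) * (\sum_i w i * a i ^+ 2).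
Proof.
move=> w0; have := cauchy_schwarz_sum (fun=> 1) a w0.
under eq_bigr do rewrite mulr1.
by under [X in _ <= X * _]eq_bigr do rewrite expr1n mulr1.
Qed.

Lemma cauchy_schwarz (I : finType) (a b : I -> R) :
  (\sum_i a i * b i) ^+ 2 <= (\sum_i a i ^+ 2) * (\sum_i b i ^+ 2).
Proof.
have := @cauchy_schwarz_sum I (fun=> 1) a b (fun=> ler01).
under eq_bigr do rewrite mul1r.
under [X in _ <= X * _]eq_bigr do rewrite mul1r.
by under [X in _ <= _ * X]eq_bigr do rewrite mul1r.
Qed.

Lemma sqr_sum_le (n : nat) (a : 'I_n -> R) :
  (\sum_i a i) ^+ 2 <= n%:R * \sum_i a i ^+ 2.
Proof.
have := @cauchy_schwarz_sum1 _ (fun=> 1) a (fun=> ler01).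
rewrite sumr_const card_ord.
under eq_bigr do rewrite mul1r.
by under [X in _ <= _ * X]eq_bigr do rewrite mul1r.
Qed.


End finite_sums.

(* [J] is within [kappa] in operator norm of the rank-one matrix [w 1 1^T], whose own norm [w N]
   may be as large as [kappa * sqrt N]. *)
Definition near_flat {R : realFieldType} (N : nat) (kappa w : R) (J : 'I_N -> 'I_N -> R) :=
  [/\ forall p q : 'I_N -> R,
        (\sum_i \sum_j p i * J i j * q j - w * (\sum_i p i) * (\sum_i q i)) ^+ 2
        <= kappa ^+ 2 * (\sum_i p i ^+ 2) * (\sum_i q i ^+ 2),
      w ^+ 2 * N%:R <= kappa ^+ 2 & forall i j, J i j = J j i].

Section near_flat.
Context {R : realFieldType} (N : nat) (kappa w : R) (J : 'I_N -> 'I_N -> R).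
Hypothesis J_flat : near_flat kappa w J.

(** Test the form against p = J q. The flat part then costs w^2 N (sum q)^2 <= kappa^2 (sum q)^2,
    hence the second summand on the right. *)
Lemma near_flat_apply (q : 'I_N -> R) :
  \sum_i (\sum_j J i j * q j) ^+ 2 <=
  2 * kappa ^+ 2 * (\sum_i q i ^+ 2 + (\sum_i q i) ^+ 2).
Proof.
have [J1 J2 _] := J_flat.
set p := fun i => \sum_j J i j * q j.
have := J1 p q.
have -> : \sum_i \sum_j p i * J i j * q j = \sum_i p i ^+ 2.
  by apply: eq_bigr => i _; under eq_bigr do rewrite -mulrA; rewrite -mulr_sumr expr2.
set S := \sum_i p i ^+ 2; set P := \sum_i p i; set Q := \sum_i q i.
set q2 := \sum_i _ ^+ 2 => le1.
have S0 : 0 <= S by apply: sumr_ge0 => i _; exact: sqr_ge0.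
have P2 : P ^+ 2 <= N%:R * S := sqr_sum_le p.
have le2 : (w * P * Q) ^+ 2 <= kappa ^+ 2 * S * Q ^+ 2.
  rewrite 2!exprMn; apply: ler_wpM2r; first exact: sqr_ge0.
  apply: le_trans (_ : w ^+ 2 * (N%:R * S) <= _).
    by apply: ler_wpM2l => //; exact: sqr_ge0.
  by rewrite mulrA; apply: ler_wpM2r.
have le3 : S ^+ 2 <= (2 * kappa ^+ 2 * (q2 + Q ^+ 2)) * S.
  have -> : S = (S - w * P * Q) + w * P * Q by ring.
  rewrite {1}(_ : _ ^+ 2 = 2 * (S - w * P * Q) ^+ 2 + 2 * (w * P * Q) ^+ 2
    - (S - w * P * Q - w * P * Q) ^+ 2); last ring.
  have := sqr_ge0 (S - w * P * Q - w * P * Q).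
  rewrite subrK; nra.
have [S_eq0|SN0] := eqVneq S 0.
  rewrite S_eq0; apply: mulr_ge0; first by rewrite mulr_ge0 ?sqr_ge0.
  by apply: addr_ge0 (sqr_ge0 _); apply: sumr_ge0 => i _; exact: sqr_ge0.
by rewrite -(ler_pM2r (x := S)) -?expr2// lt0r SN0.
Qed.

(** Apply J to a basis vector: its entries sum to 1, so the flat part is harmless here. *)
Lemma near_flat_row i : \sum_j J i j ^+ 2 <= 4 * kappa ^+ 2.
Proof.
have [_ _ Jsym] := J_flat.
have := near_flat_apply (fun j => (j == i)%:R).
have -> : \sum_j (j == i)%:R = 1 :> R by rewrite (bigD1 i)//= eqxx big1 ?addr0// => j /negbTE->.
have -> : \sum_j (j == i)%:R ^+ 2 = 1 :> R.
  by rewrite (bigD1 i)//= eqxx big1 ?addr0 ?expr1n// => j /negbTE->; rewrite expr0n.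
rewrite (eq_bigr (fun j => J i j ^+ 2)) => [|j _]; last first.
  congr (_ ^+ 2); rewrite (bigD1 i)//= eqxx mulr1 big1 ?addr0// => k /negbTE->.
  by rewrite mulr0.
by rewrite expr1n; lra.
Qed.

Lemma near_flat_entry i j : J i j ^+ 2 <= 4 * kappa ^+ 2.
Proof.
apply: le_trans (near_flat_row i); rewrite (bigD1 j)//= lerDl.
by apply: sumr_ge0 => k _; exact: sqr_ge0.
Qed.

(** Test against q = 1 and p = the deviation itself. The gain 1 / N over kappa^2 is essential: it
    compensates sum_i t_i^2 = O(N) when the deviations are summed against the rates. *)
Lemma near_flat_grad :
  \sum_i ((\sum_j J i j) / N%:R - w) ^+ 2 <= kappa ^+ 2 / N%:R.
Proof.
have [J1 _ _] := J_flat.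
case: (posnP N) => [N0|N_gt0].
  rewrite big1 => [|i _]; last by have := ltn_ord i; rewrite {2}N0.
  by rewrite mulr_ge0 ?sqr_ge0// invr_ge0.
have N0 : 0 < N%:R :> R by rewrite ltr0n.
set e := fun i => (\sum_j J i j) / N%:R - w; set S := \sum_i _.
have S0 : 0 <= S by apply: sumr_ge0 => i _; exact: sqr_ge0.
have := J1 e (fun=> 1).
rewrite !sumr_const card_ord expr1n.
have -> : \sum_i \sum_j e i * J i j * 1 - w * (\sum_i e i) * N%:R = N%:R * S.
  transitivity (\sum_i (e i * (N%:R * (e i + w)))  - w * (\sum_i e i) * N%:R).
    congr (_ - _); apply: eq_bigr => i _.
    under eq_bigr do rewrite mulr1.
    by rewrite -mulr_sumr {3}/e subrK [N%:R * _]mulrC divfK// gt_eqF.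
  rewrite mulrAC mulr_sumr -sumrB /S mulr_sumr; apply: eq_bigr => i _.
  rewrite -/(e i); ring.
move=> le1; have {le1} : N%:R * S * (N%:R * S) <= kappa ^+ 2 * (N%:R * S).
  by rewrite -expr2; apply: le_trans le1 _; rewrite -/S -mulrA (mulrC S).
have [->|SN0] := eqVneq S 0; first by rewrite mulr_ge0 ?sqr_ge0// invr_ge0 ltW.
rewrite ler_pM2r; last by rewrite mulr_gt0// lt0r SN0.
by move=> NS; rewrite ler_pdivlMr// mulrC.
Qed.

(** The constant vector with entries w has squared norm w^2 N; the second clause of [near_flat] is
    made for this bound. *)
Lemma near_flat_grad_norm : (0 < N)%N ->
  \sum_i ((\sum_j J i j) / N%:R) ^+ 2 <= 4 * kappa ^+ 2.
Proof.
move=> N_gt0; have [_ J2 _] := J_flat.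
have := near_flat_grad; set e := fun i => (\sum_j J i j) / N%:R - w => le1.
have N1 : 1 <= N%:R :> R by rewrite ler1n.
have le2 : \sum_i e i ^+ 2 <= kappa ^+ 2.
  by apply: le_trans le1 _; rewrite ler_pdivrMr ?ltr0n// ler_peMr ?sqr_ge0.
have : \sum_i ((\sum_j J i j) / N%:R) ^+ 2 <= \sum_(i < N) (2 * e i ^+ 2 + 2 * w ^+ 2).
  apply: ler_sum => i _.
  have -> : (\sum_j J i j) / N%:R = e i + w by rewrite /e subrK.
  have := sqr_ge0 (e i - w); nra.
rewrite big_split /= -mulr_sumr sumr_const card_ord -mulr_natr; nra.
Qed.

End near_flat.

(** * Off-diagonal terms of the Bochner identity at a fixed configuration *)

Section offdiagonal.
Context {R : realFieldType}.

Lemma le_of_sqr_le (x y : R) : 0 <= y -> x ^+ 2 <= y ^+ 2 -> x <= y.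
Proof.
move=> y0 xy; apply: le_trans (ler_norm x) _.
by rewrite -(ler_sqr (x := `|x|)) ?nnegrE// real_normK ?num_real.
Qed.

Lemma normM_le (a b x y : R) : `|a| <= x -> `|b| <= y -> `|a * b| <= x * y.
Proof. by move=> ax by_; rewrite normrM ler_pM. Qed.

(** Here u1 = d_j t_i, u2 = d_i t_j and h = d_i d_j f. Only u2 di dj is linear in J without a factor
    h, so only there is u2 expanded to first order. In the other terms Young's inequality with
    weight kappa moves h^2 into the second-order term, at the cost of J^2 di^2 / kappa, which the
    row bound on J reduces to O(kappa). *)
Lemma offdiag_term_ge (kappa ti tj J u1 u2 di dj h : R) :
  0 < kappa -> 0 <= ti <= 2 -> 0 <= tj <= 2 ->
  J ^+ 2 <= 4 * kappa ^+ 2 ->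
  `|u1| <= 4 * ti * `|J| -> `|u2| <= 4 * tj * `|J| ->
  `|u2 + tj * (2 - tj) * J| <= 8 * tj * J ^+ 2 ->
  - (ti * di * J * (tj * (2 - tj) * dj))
  - ti * tj * (6 / kappa * (J ^+ 2 * di ^+ 2) + 22 * kappa * h ^+ 2
               + 4 * J ^+ 2 * (di ^+ 2 + dj ^+ 2))
  <= tj * u1 * (di * h - 2 * h ^+ 2) + ti * u2 * (di * dj - 2 * di * h).
Proof.
move=> k0 /andP[ti0 ti2] /andP[tj0 tj2] Jk u1J u2J u2J2.
have ij0 : 0 <= ti * tj by exact: mulr_ge0.
have J_le : `|J| <= 2 * kappa.
  apply: le_of_sqr_le; first by rewrite mulr_ge0// ltW.
  by rewrite real_normK ?num_real// exprMn; lra.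
have young : 2 * `|J| * `|di| * `|h| <= J ^+ 2 * di ^+ 2 / kappa + kappa * h ^+ 2.
  rewrite -(ler_pM2l k0) mulrDr [kappa * (_ / _)]mulrC divfK ?gt_eqF//.
  rewrite -(real_normK (num_real J)) -(real_normK (num_real di)) -(real_normK (num_real h)).
  have := sqr_ge0 (`|J| * `|di| - kappa * `|h|); nra.
have nJ0 := normr_ge0 J.
have A1 : `|tj * u1 * (di * h)| <= ti * tj * (4 * `|J| * `|di| * `|h|).
  rewrite !normrM (ger0_norm tj0).
  have := ler_wpM2l (mulr_ge0 tj0 (mulr_ge0 (normr_ge0 di) (normr_ge0 h))) u1J; nra.
have A2 : `|ti * u2 * (di * h)| <= ti * tj * (4 * `|J| * `|di| * `|h|).
  rewrite !normrM (ger0_norm ti0).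
  have := ler_wpM2l (mulr_ge0 ti0 (mulr_ge0 (normr_ge0 di) (normr_ge0 h))) u2J; nra.
have A3 : `|tj * u1 * h ^+ 2| <= ti * tj * (8 * kappa * h ^+ 2).
  rewrite normrM (ger0_norm (sqr_ge0 h)) normrM (ger0_norm tj0).
  have h1 := ler_wpM2l (mulr_ge0 tj0 (sqr_ge0 h)) u1J.
  have h2 := ler_wpM2l (mulr_ge0 ij0 (sqr_ge0 h)) J_le; nra.
have A4 : `|ti * (u2 + tj * (2 - tj) * J) * (di * dj)| <=
    ti * tj * (4 * J ^+ 2 * (di ^+ 2 + dj ^+ 2)).
  rewrite !normrM (ger0_norm ti0).
  have dd : 2 * (`|di| * `|dj|) <= di ^+ 2 + dj ^+ 2.
    rewrite -(real_normK (num_real di)) -(real_normK (num_real dj)).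
    have := sqr_ge0 (`|di| - `|dj|); nra.
  have h1 := ler_wpM2l (mulr_ge0 ti0 (mulr_ge0 (normr_ge0 di) (normr_ge0 dj))) u2J2.
  have h2 := ler_wpM2l (mulr_ge0 ij0 (sqr_ge0 J)) dd; nra.
have young' := ler_wpM2l ij0 young.
have := ler_norm (- (tj * u1 * (di * h))); rewrite normrN => B1.
have := ler_norm (ti * u2 * (di * h)) => B2.
have := ler_norm (tj * u1 * h ^+ 2) => B3.
have := ler_norm (- (ti * (u2 + tj * (2 - tj) * J) * (di * dj))); rewrite normrN => B4.
have -> : 6 / kappa * (J ^+ 2 * di ^+ 2) = 6 * (J ^+ 2 * di ^+ 2 / kappa) by ring.
lra.
Qed.

Context (N : nat) (kappa w : R) (J U h : 'I_N -> 'I_N -> R) (t d : 'I_N -> R).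
Hypothesis kappa_gt0 : 0 < kappa.
Hypothesis J_flat : near_flat kappa w J.
Hypothesis t_bound : forall i, 0 <= t i <= 2.
Hypothesis U_le : forall i j, `|U i j| <= 4 * t j * `|J i j|.
Hypothesis U_approx : forall i j,
  `|U i j + t j * (2 - t j) * J i j| <= 8 * t j * J i j ^+ 2.

Let t_ge0 i : 0 <= t i. Proof. by case/andP: (t_bound i). Qed.
Let t_le2 i : t i <= 2. Proof. by case/andP: (t_bound i). Qed.

Lemma weighted_row_le i : \sum_j t j * J i j ^+ 2 <= 8 * kappa ^+ 2.
Proof.
apply: le_trans (_ : \sum_j 2 * J i j ^+ 2 <= _).
  by apply: ler_sum => j _; rewrite ler_wpM2r ?sqr_ge0.
by rewrite -mulr_sumr; have := near_flat_row J_flat i; lra.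
Qed.

(** [near_flat] is applied to the linear term with p = t d and q = t (2 - t) d, which leaves the
    flat product. The constant 51 is 2 from this step, 48 = 6 * 8 from the Young terms, and 1 from
    64 kappa^2 <= kappa. *)
Lemma offdiag_sum_ge : kappa <= 64^-1 ->
  - (w * (\sum_i t i * d i) * (\sum_j t j * (2 - t j) * d j))
  - 51 * kappa * (\sum_i t i * d i ^+ 2)
  - 22 * kappa * (\sum_i \sum_j t i * t j * h i j ^+ 2)
  <= \sum_i \sum_j (t j * U j i * (d i * h i j - 2 * h i j ^+ 2)
                    + t i * U i j * (d i * d j - 2 * d i * h i j)).
Proof.
move=> kappa_small; have [J1 J2 Jsym] := J_flat.
set y := \sum_i t i * d i ^+ 2.
set s := \sum_i \sum_j t i * t j * h i j ^+ 2.
have y0 : 0 <= y by apply: sumr_ge0 => i _; rewrite mulr_ge0 ?sqr_ge0.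
pose p i := t i * d i; pose q j := t j * (2 - t j) * d j.
set X := \sum_i \sum_j p i * J i j * q j.
have p2 : \sum_i p i ^+ 2 <= 2 * y.
  rewrite /y mulr_sumr; apply: ler_sum => i _; rewrite /p exprMn.
  rewrite mulrA ler_wpM2r ?sqr_ge0//; have := t_ge0 i; have := t_le2 i; nra.
have q2 : \sum_i q i ^+ 2 <= 2 * y.
  rewrite /y mulr_sumr; apply: ler_sum => i _; rewrite /q exprMn.
  rewrite mulrA ler_wpM2r ?sqr_ge0//.
  have : t i * (2 - t i) <= 1 by have := sqr_ge0 (t i - 1); nra.
  have := t_ge0 i; have := t_le2 i; move: (t i) => a a2 a0 a1.
  have : 0 <= a * (2 - a) by rewrite mulr_ge0// subr_ge0.
  nra.
have X_le : X - w * (\sum_i p i) * (\sum_i q i) <= 2 * kappa * y.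
  apply: le_of_sqr_le; first by rewrite !mulr_ge0// ltW.
  apply: le_trans (J1 p q) _.
  rewrite (_ : (2 * kappa * y) ^+ 2 = kappa ^+ 2 * (2 * y) * (2 * y)); last ring.
  rewrite -[leLHS]mulrA -[leRHS]mulrA ler_wpM2l ?sqr_ge0//; apply: ler_pM => //;
    by apply: sumr_ge0 => i _; exact: sqr_ge0.
pose rest := \sum_i \sum_j t i * t j * (6 / kappa * (J i j ^+ 2 * d i ^+ 2) +
   22 * kappa * h i j ^+ 2 + 4 * J i j ^+ 2 * (d i ^+ 2 + d j ^+ 2)).
have le1 : - X - rest <= \sum_i \sum_j (t j * U j i * (d i * h i j - 2 * h i j ^+ 2)
                    + t i * U i j * (d i * d j - 2 * d i * h i j)).
  rewrite /X /rest -sumrN -sumrB; apply: ler_sum => i _.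
  rewrite -sumrN -sumrB; apply: ler_sum => j _.
  apply: offdiag_term_ge => //; last by rewrite Jsym.
  exact: near_flat_entry J_flat i j.
have row1 : \sum_i \sum_j t i * t j * (J i j ^+ 2 * d i ^+ 2) <= 8 * kappa ^+ 2 * y.
  rewrite /y mulr_sumr; apply: ler_sum => i _.
  rewrite (eq_bigr (fun j => t i * d i ^+ 2 * (t j * J i j ^+ 2))) => [|j _]; last ring.
  rewrite -mulr_sumr [leRHS]mulrC ler_wpM2l//; first by rewrite mulr_ge0 ?sqr_ge0.
  exact: weighted_row_le.
have row2 : \sum_i \sum_j t i * t j * (J i j ^+ 2 * d j ^+ 2) <= 8 * kappa ^+ 2 * y.
  rewrite exchange_big /=; apply: le_trans row1.
  by apply: ler_sum => i _; apply: ler_sum => j _; rewrite Jsym (mulrC (t j)).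
have rest_le : rest <= 49 * kappa * y + 22 * kappa * s.
  have -> : rest = 6 / kappa * (\sum_i \sum_j t i * t j * (J i j ^+ 2 * d i ^+ 2))
     + 22 * kappa * s + (4 * (\sum_i \sum_j t i * t j * (J i j ^+ 2 * d i ^+ 2))
      + 4 * (\sum_i \sum_j t i * t j * (J i j ^+ 2 * d j ^+ 2))).
    rewrite /rest /s !mulr_sumr -!big_split /=; apply: eq_bigr => i _.
    rewrite !mulr_sumr -!big_split /=; apply: eq_bigr => j _. ring.
  have : 6 / kappa * (\sum_i \sum_j t i * t j * (J i j ^+ 2 * d i ^+ 2)) <= 48 * kappa * y.
    rewrite mulrAC ler_pdivrMr//; nra.
  have : kappa * (kappa * y) <= 64^-1 * (kappa * y).
    by rewrite ler_wpM2r// mulr_ge0// ltW.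
  lra.
have -> : \sum_i t i * d i = \sum_i p i by [].
have -> : \sum_j t j * (2 - t j) * d j = \sum_i q i by [].
apply: le_trans le1; lra.
Qed.

End offdiagonal.

(** * The logistic function *)

Section logistic.
Context {R : realType}.

(** This is 1 - tanh a, where a is half the energy lost by flipping. *)
Definition logistic (a : R) : R := 2 / (1 + expR (2 * a)).

Lemma logistic_gt0 a : 0 < logistic a.
Proof. by rewrite divr_gt0// addr_gt0 ?expR_gt0. Qed.

Lemma logisticN a : logistic (- a) = 2 - logistic a.
Proof.
rewrite /logistic mulrN expRN.
have e0 := expR_gt0 (2 * a); set e := expR (2 * a) in e0 *.
by field; rewrite !gt_eqF ?addr_gt0.
Qed.

Lemma logistic_lt2 a : logistic a < 2.
Proof. by rewrite -subr_gt0 -logisticN logistic_gt0. Qed.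

Lemma expR_sub1_sub (x : R) : `|x| <= 3^-1 -> `|expR x - 1 - x| <= x ^+ 2.
Proof.
rewrite ler_norml => /andP[x1 x2].
rewrite ger0_norm; last by have := expR_ge1Dx x; lra.
(* Squaring 1 - x/2 <= exp(- x/2) gives exp x <= (1 - x/2)^-2, and (1 - x/2)^2 (1 + x + x^2) = 1 +
   x^2 (1 - 3 x + x^2) / 4, which is at least 1 for x <= 1/3. *)
suff : expR x <= 1 + x + x ^+ 2 by lra.
have h1 := expR_ge1Dx (- (x / 2)).
have pos : 0 < 1 - x / 2 by lra.
have h2 : (1 - x / 2) ^+ 2 <= expR (- x).
  rewrite (_ : - x = 2%:R * - (x / 2)); last by field.
  rewrite expRM_natl; apply: lerXn2r; rewrite ?nnegrE ?expR_ge0//; exact: ltW.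
have h3 : expR (- x) * expR x = 1 by rewrite -expRD addNr expR0.
have ex0 := expR_gt0 x.
have h4 : (1 - x / 2) ^+ 2 * expR x <= 1.
  by apply: le_trans (ler_wpM2r (ltW ex0) h2) _; rewrite h3.
rewrite -(ler_pM2l (exprn_gt0 2 pos)); apply: le_trans h4 _.
have : 0 <= x ^+ 2 * ((1 - 3 * x) + x ^+ 2).
  by apply: mulr_ge0; [exact: sqr_ge0|have := sqr_ge0 x; lra].
nra.
Qed.

(** Flipping spin i changes d_j H by -2 J_ij, so the exponent 2 a moves by x = 4 J; the bound 1/12
    on |J| below makes |x| <= 1/3. *)
Lemma logistic_shift (a J : R) (x := 4 * J) (e := expR (2 * a)) (z := expR (- x)) :
  logistic (a - 2 * J) = 2 / (1 + e * z).
Proof. by rewrite /logistic /e /z /x -expRD; congr (2 / (1 + expR _)); ring. Qed.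

Lemma logistic_shift_le (a J : R) : `|J| <= 12^-1 ->
  `|(logistic a - logistic (a - 2 * J)) / 2| <= 4 * logistic a * `|J|.
Proof.
move=> J_small; rewrite logistic_shift /logistic.
set x := 4 * J; set e := expR (2 * a); set z := expR (- x).
have e0 : 0 < e := expR_gt0 _; have z0 : 0 < z := expR_gt0 _.
have ez0 : 0 < e * z by exact: mulr_gt0.
have xJ : `|x| = 4 * `|J| by rewrite /x normrM ger0_norm.
have zx : z * expR x = 1 by rewrite -expRD addNr expR0.
have ex : `|expR x - 1| <= 2 * `|x|.
  have x3 : `|x| <= 3^-1 by lra.
  have := expR_sub1_sub x3.
  have := ler_normD (expR x - 1 - x) x; rewrite subrK.
  rewrite -(real_normK (num_real x)); have := normr_ge0 x; nra.
rewrite (_ : (2 / (1 + e) - 2 / (1 + e * z)) / 2 =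
   2 / (1 + e) * ((e * z / (1 + e * z)) * ((1 - expR x) / 2))); last first.
  have -> : expR x = z^-1 by rewrite -(mulr1 z^-1) -zx mulKf ?gt_eqF.
  by field; rewrite !gt_eqF ?addr_gt0.
rewrite normrM ger0_norm; last by rewrite divr_ge0 ?addr_ge0// ltW.
rewrite [leRHS]mulrAC [leRHS]mulrC; apply: ler_wpM2l; first by rewrite divr_ge0 ?addr_ge0// ltW.
have f1 : 0 <= e * z / (1 + e * z) <= 1.
  apply/andP; split; first by rewrite divr_ge0 ?addr_ge0// ltW.
  by rewrite ler_pdivrMr ?addr_gt0// mul1r lerDr.
rewrite normrM (ger0_norm (proj1 (andP f1))) normrM (@ger0_norm _ 2^-1) ?invr_ge0//.
rewrite distrC; have := normr_ge0 (expR x - 1); move: f1 ex; rewrite xJ.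
move: (e * z / _) `|_ - _| => f g; nra.
Qed.

(** First-order expansion, since logistic' = - logistic (2 - logistic). The remainder keeps the
    factor [logistic a], so it is small relative to the rate. *)
Lemma logistic_shift_approx (a J : R) : `|J| <= 12^-1 ->
  `|(logistic a - logistic (a - 2 * J)) / 2 + logistic a * (2 - logistic a) * J|
  <= 8 * logistic a * J ^+ 2.
Proof.
move=> J_small; rewrite logistic_shift /logistic.
set x := 4 * J; set e := expR (2 * a); set z := expR (- x).
have e0 : 0 < e := expR_gt0 _; have z0 : 0 < z := expR_gt0 _.
have ez0 : 0 < e * z by exact: mulr_gt0.
have xJ : `|x| = 4 * `|J| by rewrite /x normrM ger0_norm.
have zx : z * expR x = 1 by rewrite -expRD addNr expR0.
have b1 : `|z - 1 + x| <= x ^+ 2.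
  by have := @expR_sub1_sub (- x); rewrite normrN sqrrN opprK; apply; lra.
have b2 : `|z - 1 + x * z| <= z * x ^+ 2.
  rewrite (_ : z - 1 + x * z = - (z * (expR x - 1 - x))); last first.
    by rewrite -[X in z - X]zx; ring.
  rewrite normrN normrM (gtr0_norm z0); apply: ler_wpM2l; first exact: ltW.
  by apply: expR_sub1_sub; lra.
(* The numerator is split so that both brackets are second-order remainders, at most x^2 and z x^2;
   with the weights 1 and e they add up to x^2 (1 + e z), and the denominator cancels. *)
rewrite (_ : (2 / (1 + e) - 2 / (1 + e * z)) / 2 + _ =
   2 / (1 + e) * (e / (1 + e) * (((z - 1 + x) + e * (z - 1 + x * z)) / (2 * (1 + e * z)))));
  last by rewrite /x; field; rewrite !gt_eqF ?addr_gt0.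
rewrite normrM ger0_norm; last by rewrite divr_ge0 ?addr_ge0// ltW.
rewrite [leRHS]mulrAC [leRHS]mulrC; apply: ler_wpM2l; first by rewrite divr_ge0 ?addr_ge0// ltW.
have f1 : 0 <= e / (1 + e) <= 1.
  apply/andP; split; first by rewrite divr_ge0 ?addr_ge0// ltW.
  by rewrite ler_pdivrMr ?addr_gt0// mul1r lerDr.
rewrite normrM (ger0_norm (proj1 (andP f1))).
apply: le_trans (_ : 1 * (x ^+ 2 / 2) <= _); last by rewrite /x; nra.
apply: ler_pM => //; [by case/andP: f1|by case/andP: f1|].
have d0 : 0 < 2 * (1 + e * z) by rewrite mulr_gt0// addr_gt0.
rewrite normrM normfV (gtr0_norm d0) ler_pdivrMr//.
have := ler_normD (z - 1 + x) (e * (z - 1 + x * z)).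
rewrite [`|e * _|]normrM (gtr0_norm e0) => le1; apply: le_trans le1 _.
have := ler_wpM2l (ltW e0) b2; nra.
Qed.

Lemma logistic_shift_ge (a J : R) : `|J| <= 16^-1 ->
  logistic a / 2 <= logistic (a - 2 * J).
Proof.
move=> J_small; have J_small' : `|J| <= 12^-1 by lra.
have := logistic_shift_le a J_small'.
rewrite ler_norml => /andP[_ h]; have := ler_wpM2l (ltW (logistic_gt0 a)) J_small.
lra.
Qed.

End logistic.

(** * Gradient of the total rate at a fixed configuration *)

Section coherent_direction.
Context {R : realFieldType} (N : nat) (kappa w : R) (J U : 'I_N -> 'I_N -> R) (t : 'I_N -> R).
Hypothesis kappa_bound : 0 <= kappa <= 64^-1.
Hypothesis J_flat : near_flat kappa w J.
Hypothesis t_bound : forall i, 0 <= t i <= 2.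
Hypothesis U_approx : forall i j,
  `|U i j + t j * (2 - t j) * J i j| <= 8 * t j * J i j ^+ 2.

Let t_ge0 i : 0 <= t i. Proof. by case/andP: (t_bound i). Qed.
Let t_le2 i : t i <= 2. Proof. by case/andP: (t_bound i). Qed.

(** With U i j = d_i t_j the bracket is d_i M. Up to a bounded error its sum over j is - (J r)_i
    with r = t (2 - t), and [near_flat_apply] bounds |J r|^2. The flat direction contributes (sum
    r)^2, so the bound is of order M^2: the logarithmic gradient of M is O(1). *)
Lemma total_rate_grad (M := 1 + \sum_i t i) :
  \sum_i t i * (t i - 1 + \sum_j U i j) ^+ 2 <= 6 * M ^+ 2.
Proof.
have /andP[k0 k1] := kappa_bound.
have T0 : 0 <= \sum_i t i by apply: sumr_ge0.
pose r j := t j * (2 - t j); pose v i := \sum_j J i j * r j.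
pose eps i := \sum_j (U i j + r j * J i j).
have r0 j : 0 <= r j by rewrite mulr_ge0 ?subr_ge0.
have eps_le i : `|eps i| <= 64 * kappa ^+ 2.
  apply: le_trans (ler_norm_sum _ _ _) _.
  apply: le_trans (_ : \sum_j 8 * (t j * J i j ^+ 2) <= _).
    by apply: ler_sum => j _; rewrite mulrA; exact: U_approx.
  by rewrite -mulr_sumr; have := weighted_row_le J_flat t_bound i; lra.
have eps2 i : eps i ^+ 2 <= 1.
  have h : 64 * kappa ^+ 2 <= 1 by nra.
  rewrite -(real_normK (num_real _)); have := normr_ge0 (eps i); have := eps_le i; nra.
have term i : t i * (t i - 1 + \sum_j U i j) ^+ 2 <= t i * 6 + 6 * v i ^+ 2.
  have -> : \sum_j U i j = eps i - v i.
    by rewrite /eps /v -sumrB; apply: eq_bigr => j _; ring.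
  have h1 : (t i - 1) ^+ 2 <= 1 by have := t_ge0 i; have := t_le2 i; nra.
  have h2 : (t i - 1 + (eps i - v i)) ^+ 2 <= 3 * ((t i - 1) ^+ 2 + eps i ^+ 2 + v i ^+ 2).
    have := sqr_ge0 (t i - 1 - eps i); have := sqr_ge0 (t i - 1 + v i).
    have := sqr_ge0 (eps i + v i); nra.
  have h3 := eps2 i.
  apply: le_trans (_ : t i * (6 + 3 * v i ^+ 2) <= _); first by rewrite ler_wpM2l//; lra.
  by have := ler_wpM2r (sqr_ge0 (v i)) (t_le2 i); lra.
apply: le_trans (_ : \sum_i (t i * 6 + 6 * v i ^+ 2) <= _).
  by apply: ler_sum => i _; exact: term.
rewrite big_split /= -mulr_suml -mulr_sumr.
have := near_flat_apply J_flat r.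
set S := \sum_i r i; set V := \sum_i v i ^+ 2.
have S_le : S <= 2 * \sum_i t i.
  rewrite mulr_sumr; apply: ler_sum => i _; rewrite /r.
  by have := t_ge0 i; nra.
have S0 : 0 <= S by apply: sumr_ge0.
have r2_le : \sum_i r i ^+ 2 <= S.
  apply: ler_sum => i _; rewrite expr2 ler_piMr//.
  by rewrite /r; have := sqr_ge0 (t i - 1); nra.
move=> V_le.
have : 2 * kappa ^+ 2 * (\sum_i r i ^+ 2 + S ^+ 2) <= 2 * (4096^-1) * (S + S ^+ 2).
  apply: ler_pM; rewrite ?mulr_ge0 ?sqr_ge0//.
  - by apply: addr_ge0 (sqr_ge0 _); apply: sumr_ge0 => i _; exact: sqr_ge0.
  - nra.
  - by rewrite lerD2r.
move/(le_trans V_le); rewrite /M; clearbody V.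
move: S_le S0 T0; clear V_le r2_le; clearbody S; move: (\sum_i t i) => T; nra.
Qed.

End coherent_direction.

(** * Heat-bath dynamics *)

Section flips.
Context {R : realType} {N : nat}.
Implicit Types (f g : config N -> R) (s : config N) (i j : 'I_N).

Lemma flipK j : involutive (@flip N j).
Proof. by move=> s; apply/ffunP => k; rewrite !ffunE; case: eqP => // _; rewrite negbK. Qed.

Lemma flipC i j s : flip i (flip j s) = flip j (flip i s).
Proof. by apply/ffunP => k; rewrite !ffunE; do 2 case: eqP. Qed.

Lemma pderiv_flip j f s : pderiv j f (flip j s) = - pderiv j f s.
Proof. by rewrite /pderiv flipK -mulNr opprB. Qed.

Lemma pderivK j f s : pderiv j (pderiv j f) s = pderiv j f s.
Proof. by rewrite {1}/pderiv pderiv_flip /pderiv; field. Qed.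

Lemma pderivC i j f s : pderiv i (pderiv j f) s = pderiv j (pderiv i f) s.
Proof. by rewrite /pderiv flipC; ring. Qed.

Lemma flip_sub_pderiv j f s : f (flip j s) = f s - 2 * pderiv j f s.
Proof. by rewrite /pderiv; field. Qed.

Lemma pderivM j f g s : pderiv j (fun x => f x * g x) s =
  f s * pderiv j g s + pderiv j f s * g (flip j s).
Proof. by rewrite /pderiv; field. Qed.

Lemma pderiv_sum j (I : Type) (r : seq I) (P : pred I) (F : I -> config N -> R) s :
  pderiv j (fun x => \sum_(i <- r | P i) F i x) s = \sum_(i <- r | P i) pderiv j (F i) s.
Proof. by rewrite /pderiv -sumrB mulr_suml. Qed.

End flips.

Section glauber.
Context {R : realType} {N : nat} (H : config N -> R).
Implicit Types (f g h : config N -> R) (s : config N) (i j k : 'I_N).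
Local Notation mean := (mean H).

(* Twice the probability that heat-bath dynamics flips spin [j], i.e. [1 - s_j tanh B_j]. *)
Definition rate j s : R := logistic (pderiv j H s).

Lemma rateE j s : rate j s = logistic (pderiv j H s). Proof. by []. Qed.

Lemma rate_gt0 j s : 0 < rate j s. Proof. exact: logistic_gt0. Qed.

Lemma rate_bound j s : 0 <= rate j s <= 2.
Proof. by rewrite !ltW ?rate_gt0 ?logistic_lt2. Qed.

Lemma rate_flip j s : rate j (flip j s) = 2 - rate j s.
Proof. by rewrite /rate pderiv_flip logisticN. Qed.

Lemma partition_function_gt0 : 0 < \sum_(t : config N) expR (H t).
Proof.
rewrite (bigD1 [ffun=> false])//= ltr_pwDl ?expR_gt0//.
by apply: sumr_ge0 => s _; exact: expR_ge0.
Qed.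

Lemma gibbs_gt0 s : 0 < gibbs H s.
Proof. by rewrite divr_gt0 ?expR_gt0 ?partition_function_gt0. Qed.

Lemma gibbs_sum1 : \sum_s gibbs H s = 1.
Proof. by rewrite -mulr_suml divff// gt_eqF ?partition_function_gt0. Qed.

Lemma detailed_balance j s :
  gibbs H (flip j s) * rate j (flip j s) = gibbs H s * rate j s.
Proof.
rewrite rate_flip /gibbs /rate /logistic (flip_sub_pderiv j H) expRD expRN.
set e := expR (2 * _); have e0 : 0 < e := expR_gt0 _.
have Z0 := partition_function_gt0; set Z := \sum_ _ _ in Z0 *.
by field; rewrite !gt_eqF// addr_gt0.
Qed.

Lemma eq_mean f g : f =1 g -> mean f = mean g.
Proof. by move=> fg; apply: eq_bigr => s _; rewrite fg. Qed.

Lemma mean_cst c : mean (fun=> c) = c.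
Proof. by rewrite /Defs.mean -mulr_suml gibbs_sum1 mul1r. Qed.

Lemma meanD f g : mean (fun s => f s + g s) = mean f + mean g.
Proof. by rewrite /Defs.mean -big_split /=; apply: eq_bigr => s _; rewrite mulrDr. Qed.

Lemma meanB f g : mean (fun s => f s - g s) = mean f - mean g.
Proof. by rewrite /Defs.mean -sumrB /=; apply: eq_bigr => s _; rewrite mulrBr. Qed.

Lemma meanZ c f : mean (fun s => c * f s) = c * mean f.
Proof. by rewrite /Defs.mean mulr_sumr; apply: eq_bigr => s _; rewrite mulrCA. Qed.

Lemma mean_sum (I : Type) (r : seq I) (P : pred I) (F : I -> config N -> R) :
  mean (fun s => \sum_(i <- r | P i) F i s) = \sum_(i <- r | P i) mean (F i).
Proof.
rewrite /Defs.mean exchange_big /=; apply: eq_bigr => s _.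
by rewrite mulr_sumr.
Qed.

Lemma le_mean f g : (forall s, f s <= g s) -> mean f <= mean g.
Proof. by move=> fg; apply: ler_sum => s _; rewrite ler_wpM2l// ltW ?gibbs_gt0. Qed.

Lemma mean_ge0 f : (forall s, 0 <= f s) -> 0 <= mean f.
Proof. by move=> f0; rewrite -[leLHS](mean_cst 0); exact: le_mean. Qed.

Lemma mean_rate_flip j f :
  mean (fun s => rate j s * f (flip j s)) = mean (fun s => rate j s * f s).
Proof.
rewrite /Defs.mean (reindex_inj (inv_inj (flipK j))) /=; apply: eq_bigr => s _.
by rewrite flipK mulrA detailed_balance mulrA.
Qed.

(** The basic integration by parts: [rate j] times the Gibbs weight is invariant under the flip and
    [pderiv j f] is odd, so only the odd part of g survives. *)
Lemma mean_rate_pderiv j f g :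
  mean (fun s => rate j s * (pderiv j f s * g s)) =
  mean (fun s => rate j s * (pderiv j f s * pderiv j g s)).
Proof.
have := mean_rate_flip j (fun s => pderiv j f s * g s).
under eq_mean do rewrite pderiv_flip.
move=> h.
rewrite (@eq_mean (fun s => rate j s * (pderiv j f s * pderiv j g s))
  (fun s => 2^-1 * (rate j s * (pderiv j f s * g s)) -
            - (2^-1 * (rate j s * (- pderiv j f s * g (flip j s)))))) => [|s]; last first.
  by rewrite /pderiv; field.
rewrite meanB.
rewrite (@eq_mean (fun s => - (2^-1 * (rate j s * (- pderiv j f s * g (flip j s)))))
  (fun s => - 2^-1 * (rate j s * (- pderiv j f s * g (flip j s))))) => [|s]; last ring.
by rewrite !meanZ h; field.
Qed.

Lemma cosh_logistic (x : R) : cosh x ^- 2 = logistic x * (2 - logistic x).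
Proof.
rewrite /cosh /logistic (_ : 2 * x = x + x) ?expRD ?expRN; last ring.
have e0 := expR_gt0 x; field; rewrite gt_eqF//=; apply/eqP; have := sqr_ge0 (expR x); nra.
Qed.

Lemma coshN (x : R) : cosh (- x) = cosh x.
Proof. by rewrite /cosh opprK addrC. Qed.

(** cosh^-2 is the product of the rates at s and at its flip, t (2 - t). By reversibility <t (2 - t)
    X> = <t t X> for flip-invariant X, and the two sum to 2 <t X>. *)
Lemma dirichletE f :
  dirichlet H f = \sum_j mean (fun s => rate j s * pderiv j f s ^+ 2).
Proof.
apply: eq_bigr => j _.
have eq1 s : cosh (cavity H j s) ^- 2 = rate j s * rate j (flip j s).
  rewrite rate_flip /rate -cosh_logistic /cavity /spin.
  by case: (s j); rewrite ?expr1 ?expr0 ?mul1r// mulN1r coshN.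
under eq_mean do rewrite eq1 -mulrA.
have := mean_rate_flip j (fun s => rate j (flip j s) * pderiv j f s ^+ 2).
under eq_mean do rewrite flipK pderiv_flip sqrrN.
rewrite (@eq_mean (fun s => rate j s * (rate j (flip j s) * _))
  (fun s => 2 * (rate j s * pderiv j f s ^+ 2)
           - rate j s * (rate j s * pderiv j f s ^+ 2))) => [|s]; last first.
  by rewrite rate_flip; ring.
by rewrite meanB meanZ => h; lra.
Qed.

End glauber.

(** * Bochner identity *)

Section bochner.
Context {R : realType} {N : nat} (H : config N -> R).
Implicit Types (f g h : config N -> R) (s : config N) (i j k : 'I_N).
Local Notation mean := (mean H).
Local Notation rate := (rate H).

(** The diagonal is removed because [pderiv i] is a projection: d_i d_i f = d_i f is a first-order
    quantity. *)
Definition mixed f i j s : R := if i == j then 0 else pderiv i (pderiv j f) s.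

Definition rate_grad i j s : R := if i == j then 0 else pderiv i (rate j) s.

Definition energy f s : R := \sum_i rate i s * pderiv i f s ^+ 2.

(* The nonnegative second-order term of the Bochner identity; it pays for the error terms that
   contain mixed second differences of [f]. *)
Definition energy2 f s : R := \sum_i \sum_j rate i s * rate j s * mixed f i j s ^+ 2.

Lemma mixedC f i j s : mixed f i j s = mixed f j i s.
Proof. by rewrite /mixed eq_sym pderivC. Qed.

Lemma pderiv_rate i s : pderiv i (rate i) s = rate i s - 1.
Proof. by rewrite /pderiv rate_flip; field. Qed.

Lemma pderiv_rate_mul i f s :
  pderiv i (fun x => rate i x * pderiv i f x) s = pderiv i f s.
Proof. by rewrite pderivM pderivK pderiv_flip pderiv_rate; ring. Qed.

Lemma energy_ge0 f s : 0 <= energy f s.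
Proof. by apply: sumr_ge0 => i _; rewrite mulr_ge0 ?sqr_ge0// ltW ?rate_gt0. Qed.

Lemma dirichlet_mean f : dirichlet H f = mean (energy f).
Proof. by rewrite dirichletE -mean_sum. Qed.

Lemma mean_generator_diag i f :
  mean (fun s => (rate i s * pderiv i f s) * (rate i s * pderiv i f s)) =
  mean (fun s => rate i s * pderiv i f s ^+ 2).
Proof.
have := mean_rate_pderiv H i f (fun x => rate i x * pderiv i f x).
under eq_mean do rewrite mulrA.
by under [in X in _ = X -> _]eq_mean do rewrite pderiv_rate_mul -expr2.
Qed.

(** Integrate by parts in i, then in j. Each product rule also differentiates a rate and evaluates
    the other factor at the flipped configuration, which produces the corrections with -2. *)
Lemma mean_generator_offdiag i j f : i != j ->
  mean (fun s => (rate i s * pderiv i f s) * (rate j s * pderiv j f s)) =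
  mean (fun s => rate i s * rate j s * mixed f i j s ^+ 2 +
    (rate j s * rate_grad j i s * (pderiv i f s * mixed f i j s - 2 * mixed f i j s ^+ 2)
     + rate i s * rate_grad i j s *
         (pderiv i f s * pderiv j f s - 2 * pderiv i f s * mixed f i j s))).
Proof.
move=> ij; have ji : j != i by rewrite eq_sym.
rewrite /mixed /rate_grad (negbTE ij) (negbTE ji).
have e1 := mean_rate_pderiv H i f (fun x => rate j x * pderiv j f x).
have e2 := mean_rate_pderiv H j (pderiv i f) (fun x => rate i x * pderiv i f x).
under eq_mean do rewrite -mulrA.
rewrite e1.
rewrite (@eq_mean _ _ _ _ (fun s =>
   rate j s * (pderiv j (pderiv i f) s * (rate i s * pderiv i f s)) +
   rate i s * pderiv i (rate j) s *
     (pderiv i f s * pderiv j f s - 2 * pderiv i f s * pderiv i (pderiv j f) s)))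
  => [|s]; last first.
  by rewrite pderivM (flip_sub_pderiv i (pderiv j f)) (pderivC j i); ring.
rewrite meanD e2 -meanD; apply: eq_mean => s.
by rewrite pderivM (flip_sub_pderiv j (pderiv i f)) (pderivC j i); ring.
Qed.

Lemma mean_generator_sqr f :
  mean (fun s => (\sum_i rate i s * pderiv i f s) ^+ 2) =
  mean (energy f) + mean (energy2 f) +
  mean (fun s => \sum_i \sum_j
    (rate j s * rate_grad j i s * (pderiv i f s * mixed f i j s - 2 * mixed f i j s ^+ 2)
     + rate i s * rate_grad i j s *
         (pderiv i f s * pderiv j f s - 2 * pderiv i f s * mixed f i j s))).
Proof.
rewrite -addrA -meanD.
under eq_mean do rewrite expr2 mulr_suml.
rewrite mean_sum.
rewrite (@eq_mean _ _ _ (fun s => energy2 f s + _) (fun s => \sum_i \sum_j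
   (rate i s * rate j s * mixed f i j s ^+ 2 +
     (rate j s * rate_grad j i s * (pderiv i f s * mixed f i j s - 2 * mixed f i j s ^+ 2)
     + rate i s * rate_grad i j s *
         (pderiv i f s * pderiv j f s - 2 * pderiv i f s * mixed f i j s))))) => [|s]; last first.
  rewrite /energy2 -big_split /=; apply: eq_bigr => i _.
  by rewrite -big_split /=; apply: eq_bigr => j _.
rewrite /energy !mean_sum -big_split /=; apply: eq_bigr => i _.
under eq_mean do rewrite mulr_sumr.
rewrite !mean_sum (bigD1 i)//= [in RHS](bigD1 i)//= mean_generator_diag.
rewrite [X in _ = _ + (X + _)](@eq_mean _ _ _ _ (fun=> 0)) => [|s]; last first.
  by rewrite /mixed /rate_grad eqxx; ring.
rewrite mean_cst add0r; congr (_ + _); apply: eq_bigr => j ji.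
by apply: mean_generator_offdiag; rewrite eq_sym.
Qed.

Section nearly_flat_hessian.
Variables (kappa : R) (w : config N -> R).
Hypothesis kappa_bound : 0 < kappa <= 64^-1.
Hypothesis flat : forall s, near_flat kappa (w s) (fun i j => mixed H i j s).
Hypothesis N_gt0 : (0 < N)%N.

Let kappa_gt0 : 0 < kappa. Proof. by case/andP: kappa_bound. Qed.
Let kappa_le : kappa <= 64^-1. Proof. by case/andP: kappa_bound. Qed.
Let kappa_sqr : kappa ^+ 2 <= 4096^-1.
Proof.
have : kappa * kappa <= 64^-1 * 64^-1 by rewrite ler_pM// ltW.
by rewrite expr2; lra.
Qed.
Let rate_ge0 i s : 0 <= rate i s. Proof. exact/ltW/rate_gt0. Qed.

Lemma mixed_le i j s : `|mixed H i j s| <= 16^-1.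
Proof.
have := near_flat_entry (flat s) i j => le1.
apply: le_of_sqr_le => //; rewrite real_normK ?num_real//.
by apply: le_trans le1 _; have := kappa_sqr; lra.
Qed.

Lemma rate_gradE i j s : i != j -> rate_grad i j s =
  (logistic (pderiv j H s) - logistic (pderiv j H s - 2 * mixed H i j s)) / 2.
Proof.
move=> ij; rewrite /rate_grad /mixed (negbTE ij) {1}/pderiv.
by rewrite !rateE (flip_sub_pderiv i (pderiv j H)).
Qed.

Lemma rate_grad_le i j s : `|rate_grad i j s| <= 4 * rate j s * `|mixed H i j s|.
Proof.
have [->|ij] := eqVneq i j; first by rewrite /rate_grad /mixed eqxx normr0 mulr0.
rewrite rate_gradE//; apply: logistic_shift_le.
by apply: le_trans (mixed_le _ _ _) _; lra.
Qed.

Lemma rate_grad_approx i j s :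
  `|rate_grad i j s + rate j s * (2 - rate j s) * mixed H i j s|
  <= 8 * rate j s * mixed H i j s ^+ 2.
Proof.
have [->|ij] := eqVneq i j.
  by rewrite /rate_grad /mixed eqxx mulr0 addr0 normr0 expr0n mulr0.
rewrite rate_gradE//; apply: logistic_shift_approx.
by apply: le_trans (mixed_le _ _ _) _; lra.
Qed.

Lemma rate_flip_ge i j s : i != j -> rate j s / 2 <= rate j (flip i s).
Proof.
move=> ij; rewrite !rateE (flip_sub_pderiv i (pderiv j H)).
apply: logistic_shift_ge; have := mixed_le i j s.
by rewrite /mixed (negbTE ij).
Qed.

Definition total_rate s : R := 1 + \sum_i rate i s.

Lemma total_rate_ge1 s : 1 <= total_rate s.
Proof. by rewrite lerDl sumr_ge0. Qed.

(** The other rates change at most by a factor 2, but the rate of k itself may drop from nearly 2 to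
    nearly 0; the summand 1 in [total_rate] absorbs this. *)
Lemma total_rate_flip_ge k s : total_rate s <= 3 * total_rate (flip k s).
Proof.
rewrite /total_rate (bigD1 k)//= [in leRHS](bigD1 k)//= rate_flip.
have : (\sum_(i < N | i != k) rate i s) / 2 <= \sum_(i < N | i != k) rate i (flip k s).
  by rewrite mulr_suml; apply: ler_sum => i ik; rewrite rate_flip_ge// eq_sym.
have : 0 <= \sum_(i < N | i != k) rate i s by exact: sumr_ge0.
have /andP[] := rate_bound H k s; lra.
Qed.

Lemma pderiv_total_rate k s :
  pderiv k total_rate s = rate k s - 1 + \sum_j rate_grad k j s.
Proof.
rewrite /total_rate -pderiv_rate (bigD1 k)//= /rate_grad eqxx add0r.
transitivity (\sum_j pderiv k (rate j) s).
  rewrite -(pderiv_sum k (index_enum _) xpredT) /pderiv; congr (_ / _); ring.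
rewrite (bigD1 k)//=; congr (_ + _); apply: eq_bigr => j jk.
by rewrite eq_sym (negbTE jk).
Qed.

Lemma sum_rate_pderiv_total_rate_le s :
  \sum_k rate k s * pderiv k total_rate s ^+ 2 <= 6 * total_rate s ^+ 2.
Proof.
under eq_bigr do rewrite pderiv_total_rate.
apply: (total_rate_grad _ (flat s)); first by rewrite ltW.
- by move=> i; exact: rate_bound.
- by move=> i j; exact: rate_grad_approx.
Qed.

Section weighted_gradient.
Variables (omega : 'I_N -> config N -> R) (f : config N -> R).
Hypothesis omega_bound : forall j s, 0 <= omega j s <= 2 * rate j s.
Hypothesis omega_grad : forall k j s, k != j ->
  `|pderiv k (omega j) s| <= 8 * rate j s * `|mixed H k j s|.
Hypothesis omega_diag : forall k s,
  pderiv k (fun x => omega k x * pderiv k f x) s ^+ 2 <= pderiv k f s ^+ 2.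

(** The derivative of the weighted sum splits into a diagonal part, a part with mixed derivatives of
    f, and a part with gradients of the weights. For the second part Cauchy-Schwarz costs the total
    weight, at most 2 M, which the division by M cancels. The third part is small by the row bound
    on the Hessian. *)
Lemma weighted_gradient_le :
  mean (fun s => \sum_k rate k s *
    (pderiv k (fun x => \sum_j omega j x * pderiv j f x) s ^+ 2 / total_rate s))
  <= 6 * mean (energy f) + 12 * mean (energy2 f).
Proof.
pose a k s := pderiv k (fun x => omega k x * pderiv k f x) s.
pose b k s := \sum_j omega j s * mixed f k j s.
pose gr k j s := if k == j then 0 else pderiv k (omega j) s.
pose c k s := \sum_j gr k j s * pderiv j f (flip k s).
have M0 s : 0 < total_rate s := lt_le_trans ltr01 (total_rate_ge1 s).
have decomp k s : pderiv k (fun x => \sum_j omega j x * pderiv j f x) s = a k s + b k s + c k s.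
  rewrite pderiv_sum (bigD1 k)//= -addrA; congr (_ + _).
  rewrite /b /c [\sum_j omega j s * _](bigD1 k)//= [\sum_j gr k j s * _](bigD1 k)//=.
  rewrite /mixed /gr eqxx mulr0 mul0r !add0r.
  rewrite -big_split /=; apply: eq_bigr => j jk.
  by rewrite pderivM eq_sym (negbTE jk).
(* [c] sees f at the flipped configuration; reversibility replaces it by [c'] at s, and M by its
   value at the flip, which is comparable. *)
pose c' k s := \sum_j gr k j s * pderiv j f s.
have flipc k s : c k (flip k s) ^+ 2 = c' k s ^+ 2.
  rewrite /c /c' -sqrrN; congr (_ ^+ 2); rewrite -sumrN; apply: eq_bigr => j _.
  rewrite flipK /gr; case: eqP => _; first by rewrite !mul0r oppr0.
  by rewrite pderiv_flip mulNr opprK.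
have c'_le k s : c' k s ^+ 2 <= 8^-1 * energy f s.
  apply: le_trans (_ : (\sum_j rate j s * (8 * `|mixed H k j s|) * `|pderiv j f s|) ^+ 2 <= _).
    rewrite -(real_normK (num_real (c' k s))); apply: lerXn2r; rewrite ?nnegrE//.
      by apply: sumr_ge0 => j _; rewrite !mulr_ge0.
    apply: le_trans (ler_norm_sum _ _ _) _; apply: ler_sum => j _.
    rewrite normrM ler_wpM2r// /gr; case: eqP => kj; first by rewrite normr0 !mulr_ge0.
    by apply: le_trans (omega_grad s _) _; [exact/eqP|lra].
  apply: le_trans (cauchy_schwarz_sum _ _ _) _ => //.
  rewrite (eq_bigr (fun j => 64 * (rate j s * mixed H k j s ^+ 2))) => [|j _]; last first.
    by rewrite -(real_normK (num_real (mixed H k j s))); ring.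
  rewrite -mulr_sumr.
  rewrite [X in _ * X](eq_bigr (fun j => rate j s * pderiv j f s ^+ 2)) => [|j _]; last first.
    by rewrite real_normK ?num_real.
  rewrite -/(energy f s) ler_wpM2r ?energy_ge0//.
  by have := weighted_row_le (flat s) (fun i => rate_bound H i s) k; have := kappa_sqr; lra.
have inv1 s : (total_rate s)^-1 <= 1 by rewrite invf_le1 ?total_rate_ge1.
have sum_rate s : \sum_i rate i s <= total_rate s by rewrite lerDr.
apply: le_trans (_ : mean (fun s => \sum_k rate k s *
    (3 * a k s ^+ 2 / total_rate s + 3 * b k s ^+ 2 / total_rate s
     + 3 * c k s ^+ 2 / total_rate s)) <= _).
  apply: le_mean => s; apply: ler_sum => k _; rewrite ler_wpM2l// decomp -!mulrDl.
  apply: ler_wpM2r; first by rewrite invr_ge0 ltW.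
  have := sqr_ge0 (a k s - b k s); have := sqr_ge0 (a k s - c k s).
  have := sqr_ge0 (b k s - c k s); nra.
rewrite mean_sum.
rewrite (eq_bigr (fun k => mean (fun s => rate k s * (3 * a k s ^+ 2 / total_rate s +
     3 * b k s ^+ 2 / total_rate s) + rate k s * (3 * c' k s ^+ 2 / total_rate (flip k s)))));
     last first.
  move=> k _; under eq_mean do rewrite mulrDr.
  rewrite !meanD; congr (_ + _).
  rewrite -(mean_rate_flip H k); apply: eq_mean => s.
  by rewrite flipc.
rewrite -mean_sum -!meanZ -meanD; apply: le_mean => s.
set E := energy f s.
have E0 : 0 <= E := energy_ge0 f s.
have Mi0 : 0 <= (total_rate s)^-1 by rewrite invr_ge0 ltW.
have t1 : \sum_k rate k s * (3 * a k s ^+ 2 / total_rate s) <= 3 * E.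
  rewrite mulr_sumr; apply: ler_sum => k _.
  rewrite [leRHS]mulrCA ler_wpM2l//; apply: le_trans (_ : 3 * a k s ^+ 2 * 1 <= _).
    by rewrite ler_wpM2l// mulr_ge0 ?sqr_ge0.
  by rewrite mulr1 ler_wpM2l// omega_diag.
have t2 : \sum_k rate k s * (3 * b k s ^+ 2 / total_rate s) <= 12 * energy2 f s.
  rewrite mulr_sumr; apply: ler_sum => k _.
  rewrite (eq_bigr (fun j => rate k s * (rate j s * mixed f k j s ^+ 2))) => [|j _]; last ring.
  rewrite -mulr_sumr [leRHS]mulrCA ler_wpM2l// ler_pdivrMr//.
  have h1 : b k s ^+ 2 <= (\sum_j omega j s) * (\sum_j omega j s * mixed f k j s ^+ 2).
    by apply: cauchy_schwarz_sum1 => j; case/andP: (omega_bound j s).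
  have h2 : \sum_j omega j s <= 2 * total_rate s.
    apply: le_trans (_ : \sum_j 2 * rate j s <= _).
      by apply: ler_sum => j _; case/andP: (omega_bound j s).
    by rewrite -mulr_sumr ler_wpM2l.
  have h3 : \sum_j omega j s * mixed f k j s ^+ 2 <= 2 * \sum_j rate j s * mixed f k j s ^+ 2.
    rewrite mulr_sumr; apply: ler_sum => j _; rewrite mulrA ler_wpM2r ?sqr_ge0//.
    by case/andP: (omega_bound j s).
  have h4 : b k s ^+ 2 <= (2 * total_rate s) * (2 * \sum_j rate j s * mixed f k j s ^+ 2).
    apply: le_trans h1 _; apply: ler_pM => //.
      by apply: sumr_ge0 => j _; case/andP: (omega_bound j s).
    apply: sumr_ge0 => j _; rewrite mulr_ge0 ?sqr_ge0//.
    by case/andP: (omega_bound j s).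
  lra.
have t3 : \sum_k rate k s * (3 * c' k s ^+ 2 / total_rate (flip k s)) <= 3 * E.
  apply: le_trans (_ : \sum_k rate k s * (9 / 8 * E / total_rate s) <= _).
    apply: ler_sum => k _; rewrite ler_wpM2l//.
    rewrite ler_pdivrMr// mulrAC ler_pdivlMr//.
    have := total_rate_flip_ge k s; have := c'_le k s; rewrite -/E.
    have := M0 s; move: (total_rate s) (total_rate (flip k s)) => m m' m0 cE mm'.
    have := sqr_ge0 (c' k s); nra.
  rewrite -mulr_suml mulrA ler_pdivrMr//.
  have := sum_rate s; have : 0 <= \sum_i rate i s by exact: sumr_ge0.
  nra.
under eq_bigr do rewrite !mulrDr.
rewrite !big_split /=; move: t1 t2 t3; lra.
Qed.

End weighted_gradient.
End nearly_flat_hessian.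
End bochner.

(** * The flat direction of the Hessian *)

(** A square matrix with trivial kernel is invertible; this will solve the Poisson equation.
    Linearity is assumed in the form needed to expand in the Dirac basis. *)
Lemma injective_operator_surjective (R : fieldType) (T : finType)
    (phi : (T -> R) -> T -> R) :
  (forall (a : T -> R) (e : T -> T -> R) s,
     phi (fun x => \sum_t a t * e t x) s = \sum_t a t * phi (e t) s) ->
  (forall g, (forall s, phi g s = 0) -> forall s, g s = 0) ->
  forall b : T -> R, exists g, forall s, phi g s = b s.
Proof.
move=> phi_lin phi_inj b.
pose e (t x : T) : R := (t == x)%:R.
pose A : 'M[R]_#|T| := \matrix_(i, j) phi (e (enum_val i)) (enum_val j).
pose F (v : 'rV[R]_#|T|) (x : T) := v ord0 (enum_rank x).
have FA v j : (v *m A) ord0 j = phi (F v) (enum_val j).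
  have -> : F v = fun x => \sum_t F v t * e t x.
    apply/funext => x; rewrite (bigD1 x)//= /e eqxx mulr1 big1 ?addr0// => t /negbTE ->.
    by rewrite mulr0.
  rewrite phi_lin mxE [RHS](reindex (@enum_val T predT)) /=; last first.
    by apply: onW_bij; exact: enum_val_bij.
  by apply: eq_bigr => i _; rewrite mxE /F enum_valK.
have A_unit : A \in unitmx.
  rewrite -row_free_unit -kermx_eq0; apply/rowV0P => v /sub_kermxP vA0.
  apply/rowP => j; rewrite mxE -[j]enum_valK; apply: (phi_inj (F v)) => s.
  by rewrite -[s]enum_rankK -FA vA0 mxE.
exists (F (\row_j b (enum_val j) *m invmx A)) => s.
by rewrite -[s]enum_rankK -FA mulmxKV// mxE.
Qed.

Section coherent.
Context {R : realType} {N : nat} (H : config N -> R).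
Implicit Types (f g h : config N -> R) (s : config N) (i j k : 'I_N).
Local Notation mean := (mean H).
Local Notation rate := (rate H).
Variables (kappa : R) (w : config N -> R).
Hypothesis kappa_bound : 0 < kappa <= 64^-1.
Hypothesis flat : forall s, near_flat kappa (w s) (fun i j => mixed H i j s).
Hypothesis N_gt0 : (0 < N)%N.

Let kappa_gt0 : 0 < kappa. Proof. by case/andP: kappa_bound. Qed.
Let kappa_le : kappa <= 64^-1. Proof. by case/andP: kappa_bound. Qed.
Let rate_ge0 i s : 0 <= rate i s. Proof. exact/ltW/rate_gt0. Qed.
Let rate_le2 i s : rate i s <= 2. Proof. by case/andP: (rate_bound H i s). Qed.

(* [potential] applies [k - 1] to the degree-[k] part of [H], so that its gradient is the vector
   of row averages of the Hessian. *)
Definition potential s : R := (\sum_j pderiv j H s - H s) / N%:R.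

Lemma pderiv_potential k s : pderiv k potential s = (\sum_j mixed H k j s) / N%:R.
Proof.
have -> : pderiv k potential s = (\sum_j pderiv k (pderiv j H) s - pderiv k H s) / N%:R.
  rewrite -(pderiv_sum k (index_enum _) xpredT) /pderiv /potential.
  by rewrite -mulrBl; field; rewrite pnatr_eq0 -lt0n.
congr (_ / _); rewrite (bigD1 k)//= pderivK addrAC subrr add0r.
rewrite [RHS](bigD1 k)//= /mixed eqxx add0r; apply: eq_bigr => j jk.
by rewrite eq_sym (negbTE jk).
Qed.

Lemma potential_grad_le s : \sum_k rate k s * pderiv k potential s ^+ 2 <= 8 * kappa ^+ 2.
Proof.
apply: le_trans (_ : \sum_k 2 * pderiv k potential s ^+ 2 <= _).
  by apply: ler_sum => k _; rewrite ler_wpM2r ?sqr_ge0.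
rewrite -mulr_sumr; under eq_bigr do rewrite pderiv_potential.
by have := near_flat_grad_norm (flat s) N_gt0; lra.
Qed.

Lemma flat_value_le s : `|w s| <= kappa.
Proof.
have [_ le1 _] := flat s.
apply: le_of_sqr_le; first exact: ltW.
rewrite real_normK ?num_real//; apply: le_trans le1.
by rewrite ler_peMr ?sqr_ge0// ler1n.
Qed.

(** The sum of the squared rates is at most 4 N and the squared deviation at most kappa^2 / N, so N
    cancels. *)
Lemma potential_drift_le s :
  `|\sum_k rate k s * (pderiv k potential s - w s)| <= 2 * kappa.
Proof.
apply: le_of_sqr_le; first by rewrite mulr_ge0// ltW.
rewrite real_normK ?num_real//; apply: le_trans (cauchy_schwarz _ _) _.
have N1 : 0 < N%:R :> R by rewrite ltr0n.
have := near_flat_grad (flat s).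
have -> : \sum_i ((\sum_j mixed H i j s) / N%:R - w s) ^+ 2 =
          \sum_k (pderiv k potential s - w s) ^+ 2.
  by apply: eq_bigr => k _; rewrite pderiv_potential.
set e := \sum_k _ ^+ 2 => e_le.
have r_le : \sum_k rate k s ^+ 2 <= 4 * N%:R.
  apply: le_trans (_ : \sum_(k < N) 4 <= _).
    by apply: ler_sum => k _; have := rate_ge0 k s; have := rate_le2 k s; nra.
  by rewrite sumr_const card_ord mulr_natr.
apply: le_trans (_ : 4 * N%:R * (kappa ^+ 2 / N%:R) <= _).
  apply: ler_pM => //; first by apply: sumr_ge0 => k _; exact: sqr_ge0.
  by apply: sumr_ge0 => k _; exact: sqr_ge0.
by rewrite mulrACA divff ?gt_eqF// mulr1 exprMn; lra.
Qed.

(* Minus the generator applied to [f]. *)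
Definition current f s : R := \sum_i rate i s * pderiv i f s.
(** The second factor of the flat term; its weights are minus the derivative of [logistic]. *)
Definition current2 f s : R := \sum_i rate i s * (2 - rate i s) * pderiv i f s.
Local Notation M := (total_rate H).

Let sum_rate_le s : \sum_i rate i s <= M s. Proof. by rewrite lerDr. Qed.
Let M_gt0 s : 0 < M s. Proof. exact: lt_le_trans ltr01 (total_rate_ge1 H s). Qed.

Lemma current_le f s : current f s ^+ 2 <= M s * energy H f s.
Proof.
apply: le_trans (cauchy_schwarz_sum1 _ _) _ => //.
by rewrite ler_wpM2r ?energy_ge0.
Qed.

Lemma current2_le f s : current2 f s ^+ 2 <= 4 * M s * energy H f s.
Proof.
have r0 i : 0 <= rate i s * (2 - rate i s) by rewrite mulr_ge0 ?subr_ge0.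
apply: le_trans (cauchy_schwarz_sum1 _ _) _ => //.
rewrite (_ : 4 * M s * energy H f s = (2 * M s) * (2 * energy H f s)); last ring.
apply: ler_pM; [exact: sumr_ge0| |..].
- by apply: sumr_ge0 => i _; apply: mulr_ge0 (r0 i) (sqr_ge0 _).
- apply: le_trans (_ : \sum_i 2 * rate i s <= _); last by rewrite -mulr_sumr ler_wpM2l.
  by apply: ler_sum => i _; have := rate_ge0 i s; nra.
- rewrite mulr_sumr; apply: ler_sum => i _; rewrite mulrA ler_wpM2r ?sqr_ge0//.
  by have := rate_ge0 i s; nra.
Qed.

Lemma current_gradient_le f :
  mean (fun s => \sum_k rate k s * (pderiv k (current f) s ^+ 2 / M s))
  <= 6 * mean (energy H f) + 12 * mean (energy2 H f).
Proof.
apply: (weighted_gradient_le kappa_bound flat).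
- by move=> j s; rewrite rate_ge0 ler_peMl// ler1n.
- move=> k j s kj; have := rate_grad_le kappa_bound flat k j s.
  rewrite /rate_grad (negbTE kj) => /le_trans; apply.
  by rewrite ler_wpM2r// ler_wpM2r// ler_nat.
- by move=> k s; rewrite pderiv_rate_mul.
Qed.

Lemma current2_gradient_le f :
  mean (fun s => \sum_k rate k s * (pderiv k (current2 f) s ^+ 2 / M s))
  <= 6 * mean (energy H f) + 12 * mean (energy2 H f).
Proof.
apply: (weighted_gradient_le kappa_bound flat).
- move=> j s; have := rate_ge0 j s; have := rate_le2 j s => r2 r0.
  by apply/andP; split; nra.
- move=> k j s kj; have := rate_grad_le kappa_bound flat k j s.
  rewrite /rate_grad (negbTE kj) => h.
  have -> : pderiv k (fun x => rate j x * (2 - rate j x)) s =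
      pderiv k (rate j) s * (2 - rate j s - rate j (flip k s)).
    by rewrite /pderiv; field.
  rewrite (_ : 8 * rate j s * `|mixed H k j s| = 4 * rate j s * `|mixed H k j s| * 2); last ring.
  apply: normM_le h _; rewrite ler_norml.
  have := rate_ge0 j s; have := rate_le2 j s.
  have := rate_ge0 j (flip k s); have := rate_le2 j (flip k s).
  by move=> *; apply/andP; split; lra.
- move=> k s; have -> : pderiv k (fun x => rate k x * (2 - rate k x) * pderiv k f x) s =
      rate k s * (2 - rate k s) * pderiv k f s.
    by rewrite {1}/pderiv rate_flip pderiv_flip; field.
  rewrite exprMn ler_piMl ?sqr_ge0//.
  have := rate_ge0 k s; have := rate_le2 k s.
  move: (rate k s) => r r2 r0.
  apply: exprn_ile1; first by rewrite mulr_ge0 ?subr_ge0.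
  by have := sqr_ge0 (r - 1); nra.
Qed.

Lemma pderiv_quotient k (P Q : config N -> R) s :
  pderiv k (fun x => P x * Q x / M x) s =
  pderiv k P s * Q s / M s + P (flip k s) * pderiv k Q s / M s
  - P (flip k s) * Q (flip k s) * pderiv k M s / (M s * M (flip k s)).
Proof. by rewrite /pderiv; field; rewrite !gt_eqF. Qed.

(** c will be a derivative of [potential], of size O(kappa), so that c^2 / kappa is still O(kappa)
    in Young's inequality. The value of P at the flip is paired with M at the flip, so that
    reversibility can carry the whole term back to s. *)
Lemma pderiv_quotient_le k c (P Q : config N -> R) s :
  c * pderiv k (fun x => P x * Q x / M x) s <=
  c ^+ 2 * Q s ^+ 2 / (2 * kappa * M s) + kappa / 2 * (pderiv k P s ^+ 2 / M s)
  + c ^+ 2 * P (flip k s) ^+ 2 / (2 * kappa * M (flip k s))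
  + 3 * kappa / 2 * (pderiv k Q s ^+ 2 / M s)
  + `|c| * `|P (flip k s) * Q (flip k s)| * `|pderiv k M s| / (M s * M (flip k s)).
Proof.
rewrite pderiv_quotient.
have MM : M (flip k s) <= 3 * M s.
  by have := total_rate_flip_ge kappa_bound flat k (flip k s); rewrite flipK.
move: (M_gt0 s) (M_gt0 (flip k s)) MM.
move: (M s) (M (flip k s)) => m m' m0 m0' MM.
move: (P (flip k s)) (Q (flip k s)) (P s) (Q s) => P' Q' P0 Q0.
move: (pderiv k P s) (pderiv k Q s) (pderiv k M s) => dP dQ dM.
have A1 : c * (dP * Q0 / m) <= c ^+ 2 * Q0 ^+ 2 / (2 * kappa * m) + kappa / 2 * (dP ^+ 2 / m).
  rewrite -subr_ge0 (_ : _ - _ = (c * Q0 - kappa * dP) ^+ 2 / (2 * kappa * m)).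
    by rewrite divr_ge0 ?sqr_ge0// !mulr_ge0// ltW.
  by field; rewrite !gt_eqF.
have A2 : c * (P' * dQ / m) <=
    c ^+ 2 * P' ^+ 2 / (2 * kappa * m') + 3 * kappa / 2 * (dQ ^+ 2 / m).
  apply: le_trans (_ : c ^+ 2 * P' ^+ 2 / (2 * kappa * m') +
                       kappa / 2 * (dQ ^+ 2 * m' / m ^+ 2) <= _).
    rewrite -subr_ge0 (_ : _ - _ = (c * P' * m - kappa * dQ * m') ^+ 2 / (2 * kappa * m' * m ^+ 2)).
      by rewrite divr_ge0 ?sqr_ge0// !mulr_ge0 ?sqr_ge0// ltW.
    by field; rewrite !gt_eqF.
  rewrite lerD2l (_ : 3 * kappa / 2 * (dQ ^+ 2 / m) = kappa / 2 * (3 * m * (dQ ^+ 2 / m ^+ 2))).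
    rewrite (_ : dQ ^+ 2 * m' / m ^+ 2 = m' * (dQ ^+ 2 / m ^+ 2)); last ring.
    rewrite ler_wpM2l//; first by rewrite divr_ge0// ltW.
    by rewrite ler_wpM2r// divr_ge0 ?sqr_ge0.
  by field; rewrite gt_eqF.
have A3 : c * - (P' * Q' * dM / (m * m')) <= `|c| * `|P' * Q'| * `|dM| / (m * m').
  apply: le_trans (ler_norm _) _.
  rewrite normrM normrN [`|_ / _|]normrM normfV [`|m * m'|]gtr0_norm ?mulr_gt0//.
  by rewrite [`|P' * Q' * dM|]normrM !mulrA.
rewrite mulrDr mulrDr; lra.
Qed.

(* The factor [w] is too large to be estimated directly. However, [w] times the total rate is, up
   to [O(kappa)], minus the generator applied to [potential], and one integration by parts turns
   this into a product of gradients, where [potential] has gradient [O(kappa)]. *)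
Lemma mean_coherent_le f :
  mean (fun s => w s * current f s * current2 f s) <=
  80 * kappa * mean (energy H f) + 24 * kappa * mean (energy2 H f).
Proof.
pose P := current f; pose Q := current2 f.
pose Z s := P s * Q s / M s; pose c k s := pderiv k potential s.
have E0 s : 0 <= energy H f s := energy_ge0 H f s.
have PQ_le s : `|P s * Q s| <= 2 * M s * energy H f s.
  apply: le_of_sqr_le; first by rewrite !mulr_ge0// ltW.
  rewrite real_normK ?num_real// exprMn.
  have -> : (2 * M s * energy H f s) ^+ 2 =
            (M s * energy H f s) * (4 * M s * energy H f s) by ring.
  by apply: ler_pM; rewrite ?sqr_ge0 ?current_le ?current2_le.
(* Since the rates sum to M - 1, w P Q = w M Z is the drift of [potential] times Z plus a remainder,
   and that remainder is O(kappa) Z. *)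
have split s : w s * P s * Q s =
    \sum_k rate k s * (c k s * Z s) + (w s - \sum_k rate k s * (c k s - w s)) * Z s.
  rewrite (_ : \sum_k rate k s * (c k s - w s) =
               \sum_k rate k s * c k s - w s * \sum_k rate k s); last first.
    by rewrite mulr_sumr -sumrB; apply: eq_bigr => k _; ring.
  rewrite (_ : \sum_k rate k s * (c k s * Z s) = (\sum_k rate k s * c k s) * Z s); last first.
    by rewrite mulr_suml; apply: eq_bigr => k _; ring.
  have -> : \sum_k rate k s = M s - 1 by rewrite /total_rate; ring.
  by rewrite /Z; field; rewrite gt_eqF.
under eq_mean do rewrite split.
rewrite meanD.
have first : mean (fun s => (w s - \sum_k rate k s * (c k s - w s)) * Z s) <=
             6 * kappa * mean (energy H f).
  rewrite -meanZ; apply: le_mean => s; apply: le_trans (ler_norm _) _.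
  rewrite (_ : 6 * kappa * energy H f s = 3 * kappa * (2 * energy H f s)); last ring.
  apply: normM_le.
    apply: le_trans (ler_normB _ _) _.
    by have := flat_value_le s; have := potential_drift_le s; rewrite /c; lra.
  rewrite /Z normrM normfV (gtr0_norm (M_gt0 s)) ler_pdivrMr//.
  by have := PQ_le s; lra.
have -> : mean (fun s => \sum_k rate k s * (c k s * Z s)) =
          mean (fun s => \sum_k rate k s * (c k s * pderiv k Z s)).
  by rewrite !mean_sum; apply: eq_bigr => k _; exact: mean_rate_pderiv.
pose T3 k s := c k s ^+ 2 * P s ^+ 2 / (2 * kappa * M s).
pose T5 k s := `|c k s| * `|P s * Q s| * `|pderiv k M s| / (M (flip k s) * M s).
pose rest k s := c k s ^+ 2 * Q s ^+ 2 / (2 * kappa * M s) + kappa / 2 * (pderiv k P s ^+ 2 / M s)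
  + 3 * kappa / 2 * (pderiv k Q s ^+ 2 / M s).
(* [T3] and [T5] collect what [pderiv_quotient_le] evaluates at the flip; under the mean they may be
   read at s. *)
have step1 : mean (fun s => \sum_k rate k s * (c k s * pderiv k Z s)) <=
             mean (fun s => \sum_k rate k s * (rest k s + T3 k s + T5 k s)).
  apply: le_trans (_ : mean (fun s => \sum_k (rate k s * rest k s +
      rate k s * T3 k (flip k s) + rate k s * T5 k (flip k s))) <= _).
    apply: le_mean => s; apply: ler_sum => k _; rewrite -!mulrDr ler_wpM2l//.
    apply: le_trans (pderiv_quotient_le k (c k s) P Q s) _.
    rewrite /rest /T3 /T5 flipK /c !pderiv_flip sqrrN !normrN; lra.
  rewrite !mean_sum; apply: ler_sum => k _.
  rewrite 2!meanD (mean_rate_flip H k (T3 k)) (mean_rate_flip H k (T5 k)) -2!meanD.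
  by apply: le_mean => s; rewrite -!mulrDr.
have step2 s : \sum_k rate k s * (rest k s + T3 k s + T5 k s) <=
   62 * kappa * energy H f s + kappa / 2 * (\sum_k rate k s * (pderiv k P s ^+ 2 / M s))
   + 3 * kappa / 2 * (\sum_k rate k s * (pderiv k Q s ^+ 2 / M s)).
  have Mi : 0 < (M s)^-1 by rewrite invr_gt0.
  have G := potential_grad_le s.
  have rcge0 : 0 <= \sum_k rate k s * c k s ^+ 2.
    by apply: sumr_ge0 => k _; rewrite mulr_ge0 ?sqr_ge0.
  have s1 : \sum_k rate k s * (c k s ^+ 2 * Q s ^+ 2 / (2 * kappa * M s)) <=
            16 * kappa * energy H f s.
    rewrite (eq_bigr (fun k => rate k s * c k s ^+ 2 * (Q s ^+ 2 / (2 * kappa * M s))));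
      last by move=> k _; ring.
    rewrite -mulr_suml.
    rewrite (_ : 16 * kappa * _ = 8 * kappa ^+ 2 * (4 * M s * energy H f s / (2 * kappa * M s)));
      last by field; rewrite !gt_eqF.
    apply: ler_pM => //; first by rewrite divr_ge0 ?sqr_ge0// !mulr_ge0// ltW.
    by rewrite ler_wpM2r ?current2_le// invr_ge0 !mulr_ge0// ltW.
  have s3 : \sum_k rate k s * T3 k s <= 4 * kappa * energy H f s.
    rewrite (eq_bigr (fun k => rate k s * c k s ^+ 2 * (P s ^+ 2 / (2 * kappa * M s))));
      last by move=> k _; rewrite /T3; ring.
    rewrite -mulr_suml.
    rewrite (_ : 4 * kappa * _ = 8 * kappa ^+ 2 * (M s * energy H f s / (2 * kappa * M s)));
      last by field; rewrite !gt_eqF.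
    apply: ler_pM => //; first by rewrite divr_ge0 ?sqr_ge0// !mulr_ge0// ltW.
    by rewrite ler_wpM2r ?current_le// invr_ge0 !mulr_ge0// ltW.
  have s5 : \sum_k rate k s * T5 k s <= 42 * kappa * energy H f s.
    (* The logarithmic gradient of M, whose weighted square is at most 6. Young's inequality against
       c then gives 42 = 3 * 8 + 3 * 6. *)
    pose u k := pderiv k M s / M s.
    have u2 : \sum_k rate k s * u k ^+ 2 <= 6.
      rewrite (eq_bigr (fun k => rate k s * pderiv k M s ^+ 2 / M s ^+ 2)) => [|k _]; last first.
        by rewrite /u exprMn exprVn mulrA.
      rewrite -mulr_suml ler_pdivrMr ?exprn_gt0//.
      exact: (sum_rate_pderiv_total_rate_le kappa_bound flat).
    have T5_le k : T5 k s <= 3 * energy H f s * (c k s ^+ 2 / kappa + kappa * u k ^+ 2).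
      apply: le_trans (_ : 6 * energy H f s * (`|c k s| * `|u k|) <= _); last first.
        rewrite (_ : 6 * _ = 3 * energy H f s * 2); last ring.
        rewrite -mulrA ler_wpM2l ?mulr_ge0//.
        rewrite -(real_normK (num_real (c k s))) -(real_normK (num_real (u k))).
        rewrite -subr_ge0 (_ : _ - _ = (`|c k s| - kappa * `|u k|) ^+ 2 / kappa).
          by rewrite divr_ge0 ?sqr_ge0// ltW.
        by field; rewrite gt_eqF.
      have -> : `|u k| = `|pderiv k M s| / M s.
        by rewrite /u normrM normfV (gtr0_norm (M_gt0 s)).
      rewrite /T5 invfM.
      have inv_le : (M (flip k s))^-1 <= 3 / M s.
        rewrite -[leLHS]mul1r ler_pdivrMr// mulrAC ler_pdivlMr// mul1r.
        exact: total_rate_flip_ge kappa_bound flat k s.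
      have PQ2 : `|P s * Q s| * (M (flip k s))^-1 <= 6 * energy H f s.
        apply: le_trans (_ : 2 * M s * energy H f s * (3 / M s) <= _).
          by apply: ler_pM => //; rewrite invr_ge0 ltW.
        by rewrite le_eqVlt (_ : _ * _ = 6 * energy H f s) ?eqxx//; field; rewrite gt_eqF.
      rewrite [leLHS](_ : _ =
        `|P s * Q s| * (M (flip k s))^-1 * (`|c k s| * (`|pderiv k M s| / M s)));
        last by ring.
      by rewrite ler_wpM2r// !mulr_ge0// ltW.
    apply: le_trans (_ : \sum_k (3 * energy H f s / kappa * (rate k s * c k s ^+ 2) +
       3 * energy H f s * kappa * (rate k s * u k ^+ 2)) <= _).
      apply: ler_sum => k _; apply: le_trans (ler_wpM2l (rate_ge0 k s) (T5_le k)) _.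
      by rewrite le_eqVlt; apply/orP; left; apply/eqP; ring.
    rewrite big_split /= -!mulr_sumr.
    apply: le_trans (_ : 3 * energy H f s / kappa * (8 * kappa ^+ 2) +
       3 * energy H f s * kappa * 6 <= _).
      by apply: lerD; rewrite ler_wpM2l// ?divr_ge0 ?mulr_ge0// ltW.
    by rewrite le_eqVlt; apply/orP; left; apply/eqP; field; rewrite gt_eqF.
  rewrite (_ : \sum_k _ =
     \sum_k rate k s * (c k s ^+ 2 * Q s ^+ 2 / (2 * kappa * M s))
     + kappa / 2 * (\sum_k rate k s * (pderiv k P s ^+ 2 / M s))
     + 3 * kappa / 2 * (\sum_k rate k s * (pderiv k Q s ^+ 2 / M s))
     + \sum_k rate k s * T3 k s + \sum_k rate k s * T5 k s); first lra.
  rewrite !mulr_sumr -!big_split /=; apply: eq_bigr => k _; rewrite /rest; ring.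
have step3 : mean (fun s => \sum_k rate k s * (rest k s + T3 k s + T5 k s)) <=
    62 * kappa * mean (energy H f)
    + kappa / 2 * (6 * mean (energy H f) + 12 * mean (energy2 H f))
    + 3 * kappa / 2 * (6 * mean (energy H f) + 12 * mean (energy2 H f)).
  apply: le_trans (le_mean _ step2) _.
  rewrite 2!meanD !meanZ; apply: lerD; [apply: lerD => //|].
    by rewrite ler_wpM2l ?divr_ge0 ?current_gradient_le// ltW.
  by rewrite ler_wpM2l ?divr_ge0 ?mulr_ge0 ?current2_gradient_le// ltW.
move: step1 step3 first; move: (mean (energy H f)) (mean (energy2 H f)) => x y; lra.
Qed.

(** 131 = 51 + 80 collects the off-diagonal and the flat errors. The second-order errors add up to
    (22 + 24) kappa times the mean of [energy2], less than that mean as kappa <= 1/64. *)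
Lemma generator_sqr_ge f :
  (1 - 131 * kappa) * mean (energy H f) <= mean (fun s => current f s ^+ 2).
Proof.
rewrite [leRHS](mean_generator_sqr H f).
have S0 : 0 <= mean (energy2 H f).
  apply: mean_ge0 => s; apply: sumr_ge0 => i _; apply: sumr_ge0 => j _.
  by apply: mulr_ge0 (sqr_ge0 _); exact: mulr_ge0.
set X := (X in _ <= _ + X).
suff : - mean (fun s => w s * current f s * current2 f s) - 51 * kappa * mean (energy H f)
     - 22 * kappa * mean (energy2 H f) <= X.
  have := mean_coherent_le f; have := ler_wpM2r S0 kappa_le; lra.
rewrite -[- mean _]mulN1r -!meanZ -!meanB; apply: le_mean => s.
rewrite mulN1r.
apply: (@offdiag_sum_ge R N kappa (w s) (fun i j => mixed H i j s)
  (fun i j => rate_grad H i j s) (fun i j => mixed f i j s) (rate^~ s)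
  (fun i => pderiv i f s)) => //.
- by move=> i; exact: rate_bound.
- by move=> i j; exact: rate_grad_le kappa_bound flat i j s.
- by move=> i j; exact: rate_grad_approx kappa_bound flat i j s.
Qed.

End coherent.

(** * From the Bochner inequality to the inverse gap *)

Section poincare.
Context {R : realType} {N : nat} (H : config N -> R).
Implicit Types (f g h : config N -> R) (s : config N) (i j k : 'I_N).
Local Notation mean := (mean H).
Local Notation rate := (rate H).

Lemma pderiv_eq0_cst g : (forall i s, pderiv i g s = 0) -> forall s, g s = g [ffun=> false].
Proof.
move=> g0 s; have [n] := ubnP #|[pred i | s i]|; elim: n s => // n IH s; rewrite ltnS => sn.
have [i /= si|s0] := pickP [pred i | s i]; last first.
  by congr g; apply/ffunP => i; rewrite ffunE; exact: s0.
have -> : g s = g (flip i s) by rewrite flip_sub_pderiv g0 mulr0 subr0.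
apply: IH; apply: leq_trans sn; apply: proper_card; apply/properP; split.
  by apply/fintype.subsetP => k; rewrite !inE /flip ffunE; case: eqP => // ->; rewrite si.
by exists i; rewrite !inE// /flip ffunE eqxx si.
Qed.

Lemma mean_energy_gt0 f : (forall c, f <> cst c) -> 0 < mean (energy H f).
Proof.
move=> f_nc; rewrite lt0r mean_ge0 ?andbT; last by move=> s; exact: energy_ge0.
apply/eqP => E0; apply: (f_nc (f [ffun=> false])); apply/funext => s /=.
apply: pderiv_eq0_cst => i {}s.
move/eqP: E0; rewrite psumr_eq0 => [/allP /(_ s (mem_index_enum _))|x _]; last first.
  by rewrite mulr_ge0 ?energy_ge0// ltW ?gibbs_gt0.
rewrite mulf_eq0 gt_eqF ?gibbs_gt0//= psumr_eq0 => [/allP /(_ i (mem_index_enum _))|j _].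
  by rewrite /= mulf_eq0 gt_eqF ?rate_gt0//= sqrf_eq0 => /eqP.
by rewrite mulr_ge0 ?sqr_ge0// ltW ?rate_gt0.
Qed.

Lemma pderiv_cst i (c : R) s : pderiv i (cst c) s = 0.
Proof. by rewrite /pderiv subrr mul0r. Qed.

Lemma mean_mul_current f g :
  mean (fun s => f s * current H g s) =
  mean (fun s => \sum_i rate i s * (pderiv i g s * pderiv i f s)).
Proof.
rewrite (@eq_mean _ _ _ _ (fun s => \sum_i rate i s * (pderiv i g s * f s))) => [|s]; last first.
  by rewrite /current mulr_sumr; apply: eq_bigr => i _; ring.
by rewrite !mean_sum; apply: eq_bigr => i _; exact: mean_rate_pderiv.
Qed.

Lemma mean_current g : mean (current H g) = 0.
Proof.
have := mean_mul_current (cst 1) g.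
under eq_mean do rewrite mul1r.
move=> ->; rewrite -[RHS](mean_cst H); apply: eq_mean => s.
by apply: big1 => i _; rewrite pderiv_cst !mulr0.
Qed.

(** The generator kills constants; adding [mean g] makes it injective, because the range of
    [current] has mean zero and a function of zero energy is constant. *)
Lemma poisson_equation f : exists g, forall s, current H g s = f s - mean f.
Proof.
pose phi g s := current H g s + mean g.
have phi_mean g : mean (phi g) = mean g by rewrite /phi meanD mean_current mean_cst add0r.
have [|g gz s|g phig] := @injective_operator_surjective _ _ phi _ _ f.
- move=> a e s; rewrite /phi /current.
  under [RHS]eq_bigr do rewrite mulrDr.
  rewrite big_split /= mean_sum; congr (_ + _).
    under [RHS]eq_bigr do rewrite mulr_sumr.
    rewrite exchange_big /=; apply: eq_bigr => i _; rewrite pderiv_sum mulr_sumr.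
    by apply: eq_bigr => t _; rewrite /pderiv; ring.
  by apply: eq_bigr => t _; rewrite meanZ.
- have mg0 : mean g = 0 by rewrite -phi_mean -[RHS](mean_cst H); apply: eq_mean.
  have cg0 x : current H g x = 0 by have := gz x; rewrite /phi mg0 addr0.
  have Eg0 : mean (energy H g) = 0.
    have := mean_mul_current g g.
    rewrite (@eq_mean _ _ _ _ (fun=> 0)) ?mean_cst => [h|x]; last by rewrite cg0 mulr0.
    rewrite h; apply: eq_mean => x; apply: eq_bigr => i _; by rewrite expr2.
  have [c gc] : exists c, g = cst c.
    apply: contrapT => /forallNP /mean_energy_gt0; by rewrite Eg0 ltxx.
  by move: mg0; rewrite gc mean_cst.
exists g => s; rewrite -phig /phi (_ : mean f = mean g) ?addrK//.
by rewrite -[RHS]phi_mean; apply: eq_mean => x; rewrite phig.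
Qed.

(** Solve L g = f - <f> up to sign. The variance V of f is both <(L g)^2> and the Dirichlet pairing
    of f with g, so that 2 V <= D(f) / lambda + lambda D(g) <= D(f) / lambda + V. *)
Lemma covar_le_dirichlet (lambda : R) : 0 < lambda ->
  (forall g, lambda * mean (energy H g) <= mean (fun s => current H g s ^+ 2)) ->
  forall f, lambda * covar H f f <= dirichlet H f.
Proof.
move=> l0 gap f; have [g gE] := poisson_equation f.
have v1 : mean (fun s => current H g s ^+ 2) = covar H f f.
  under eq_mean do rewrite gE.
  rewrite (@eq_mean _ _ _ _ (fun s => f s * f s - 2 * mean f * f s + mean f ^+ 2)) => [|s].
    by rewrite meanD meanB meanZ mean_cst /covar; ring.
  by ring.
have v2 : mean (fun s => current H g s ^+ 2) = mean (fun s => f s * current H g s).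
  rewrite (@eq_mean _ _ _ (fun s => _ ^+ 2)
    (fun s => f s * current H g s - mean f * current H g s)) => [|s].
    by rewrite meanB meanZ mean_current mulr0 subr0.
  by rewrite expr2 {1}gE mulrBl.
have young : 2 * mean (fun s => f s * current H g s) <=
    lambda^-1 * mean (energy H f) + lambda * mean (energy H g).
  rewrite mean_mul_current -!meanZ -meanD; apply: le_mean => s.
  rewrite /energy !mulr_sumr -big_split /=; apply: ler_sum => i _.
  have r0 := rate_gt0 H i s.
  rewrite -subr_ge0 (_ : _ - _ =
    rate i s * (pderiv i f s - lambda * pderiv i g s) ^+ 2 / lambda).
    by apply: divr_ge0 (ltW l0); apply: mulr_ge0 (ltW r0) (sqr_ge0 _).
  by field; rewrite gt_eqF.
rewrite dirichlet_mean -ler_pdivlMl//.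
have := gap g; move: young; rewrite -v2 v1; lra.
Qed.

Lemma inverse_gap_le (c : R) :
  (forall f, covar H f f <= c * dirichlet H f) -> (inverse_gap H <= c%:E)%E.
Proof.
move=> cD; apply: ge_ereal_sup => _ [f f_nc <-].
by rewrite lee_fin ler_pdivrMr ?cD// dirichlet_mean mean_energy_gt0.
Qed.

(** A form without quotients, convenient for measurability. Constant f are excluded by strictness,
    as both sides vanish for them. *)
Lemma lt_inverse_gap (c : R) : (c%:E < inverse_gap H)%E <->
  exists f, c * dirichlet H f < covar H f f.
Proof.
split=> [|[f cD]].
  apply: contraPP => /forallNP cD; apply/negP; rewrite -leNgt; apply: inverse_gap_le => f.
  by rewrite leNgt; apply/negP; exact: cD.
have f_nc (b : R) : f <> cst b.
  move=> fb; move: cD; rewrite fb dirichlet_mean.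
  rewrite (_ : energy H _ = cst 0) ?mean_cst; last first.
    by apply/funext => s; apply: big1 => i _; rewrite pderiv_cst expr0n mulr0.
  by rewrite mulr0 /covar (mean_cst H (b * b)) (mean_cst H b) subrr ltxx.
apply: (@lt_le_trans _ _ (covar H f f / dirichlet H f)%:E).
  by rewrite lte_fin ltr_pdivlMr// dirichlet_mean mean_energy_gt0.
by apply: ereal_sup_ubound; exists f.
Qed.

End poincare.

Lemma nearly_flat_inverse_gap_le {R : realType} {N : nat} (H : config N -> R)
    (kappa : R) (w : config N -> R) :
  0 < kappa <= 200^-1 -> (0 < N)%N ->
  (forall s, near_flat kappa (w s) (fun i j => mixed H i j s)) ->
  (inverse_gap H <= ((1 - 131 * kappa)^-1)%:E)%E.
Proof.
move=> /andP[k0 k1] N0 flat; apply: inverse_gap_le => f.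
have l0 : 0 < 1 - 131 * kappa by lra.
rewrite ler_pdivlMl//; apply: covar_le_dirichlet => // g.
apply: generator_sqr_ge => //; apply/andP; split => //; lra.
Qed.

(** * Independent Gaussian variables *)

Section weighted_pushforward.
Context d d' (T : measurableType d) (T' : measurableType d') (R : realType).
Variables (mu : {measure set T -> \bar R}) (nu : {measure set T' -> \bar R}).
Variables (Z : T -> R) (X : T -> T') (c : R).
Hypotheses (mZ : measurable_fun setT Z) (Z_ge0 : forall w, 0 <= Z w).
Hypotheses (mX : measurable_fun setT X).
Hypothesis Z_indic : forall A, measurable A ->
  (\int[mu]_w (Z w * \1_A (X w))%:E = c%:E * nu A)%E.

Import HBNNSimple.

(** Serves twice: with Z the normal density, and with Z a product of functions of variables
    independent of X. Simple functions and monotone convergence extend the identity from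
    indicators. *)
Lemma ge0_integral_weighted_pushforward (f : T' -> R) :
  measurable_fun setT f -> (forall x, 0 <= f x) ->
  (\int[mu]_w (Z w * f (X w))%:E = c%:E * \int[nu]_x (f x)%:E)%E.
Proof.
move=> mf f_ge0.
have mEf : measurable_fun [set: T'] (fun x => (f x)%:E) by exact/measurable_EFinP.
pose h := nnsfun_approx measurableT mEf.
have h_cvg x : (EFin \o h^~ x) n @[n --> \oo] --> (f x)%:E.
  by apply: cvg_nnsfun_approx => // y _ /=; rewrite lee_fin.
have h_nd x : nondecreasing_seq (EFin \o h^~ x).
  by move=> m n mn; rewrite lee_fin; exact/lefP/nd_nnsfun_approx.
have mh n : measurable_fun setT (h n) by exact: measurable_funP.
have -> : (\int[nu]_x (f x)%:E = limn (fun n => \int[nu]_x (h n x)%:E))%E.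
  rewrite -monotone_convergence//.
  - by apply: eq_integral => x _; apply/esym/cvg_lim => //; exact: h_cvg.
  - by move=> n; exact/measurable_EFinP.
  - by move=> n x _; rewrite lee_fin.
  - by move=> x _; exact: h_nd.
have -> : (\int[mu]_w (Z w * f (X w))%:E = limn (fun n => \int[mu]_w (Z w * h n (X w))%:E))%E.
  rewrite -monotone_convergence//.
  - apply: eq_integral => w _; apply/esym/cvg_lim => //.
    exact: (@cvgeZl _ _ _ _ _ (Z w)%:E _ (h_cvg (X w))).
  - move=> n; apply/measurable_EFinP; apply: measurable_funM => //.
    exact: measurableT_comp (mh n) mX.
  - by move=> n w _; rewrite lee_fin mulr_ge0.
  - by move=> w _ m n mn; rewrite lee_fin ler_wpM2l//; exact/lefP/nd_nnsfun_approx.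
rewrite -limeMl//; last first.
  apply: ereal_nondecreasing_is_cvgn => m n mn; apply: ge0_le_integral => //.
  - by move=> x _; rewrite lee_fin.
  - exact/measurable_EFinP.
  - exact/measurable_EFinP.
  - by move=> x _; exact: h_nd.
congr (limn _); apply/funext => n.
have -> : (\int[nu]_x (h n x)%:E = \sum_(r \in range (h n)) (r%:E * nu (h n @^-1` [set r])))%E.
  under eq_integral do rewrite fimfunE -fsumEFin//.
  rewrite ge0_integral_fsum//.
  - apply: eq_fsbigr => r rh; rewrite integralZl_indic_nnsfun//.
    by rewrite integral_indic// setIT.
  - by move=> r; exact/measurable_EFinP/measurable_funM.
  - by move=> r x _; rewrite nnfun_muleindic_ge0.
have mprod r : measurable_fun setT (fun w => Z w * \1_(h n @^-1` [set r]) (X w)).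
  apply: measurable_funM => //.
  have mA : measurable_fun setT (\1_(h n @^-1` [set r]) : T' -> R) by exact: measurable_indic.
  exact: measurableT_comp mA mX.
have -> : (\int[mu]_w (Z w * h n (X w))%:E =
    \int[mu]_w \sum_(r \in range (h n)) (r * (Z w * \1_(h n @^-1` [set r]) (X w)))%:E)%E.
  apply: eq_integral => w _; rewrite fimfunE mulr_fsumr fsumEFin//.
  by congr (_%:E); apply: eq_fsbigr => r _; rewrite mulrCA.
rewrite ge0_integral_fsum//; last 2 first.
- by move=> r; apply/measurable_EFinP; apply: measurable_funM => //; exact: mprod.
- move=> r w _; rewrite lee_fin.
  have := nnfun_muleindic_ge0 (h n) r (X w); rewrite lee_fin.
  by rewrite mulrCA => h0; exact: mulr_ge0.
rewrite ge0_mule_fsumr; last first.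
  move=> r; have [rh|rh] := pselect (range (h n) r).
    by case: rh => x _ <-; rewrite mule_ge0// lee_fin.
  rewrite preimage10 ?measure0 ?mule0//.
apply: eq_fsbigr => r; rewrite inE => -[x _ <-].
under eq_integral do rewrite EFinM.
rewrite ge0_integralZl_EFin//.
- by rewrite Z_indic// muleCA.
- by move=> w _; rewrite lee_fin mulr_ge0.
- exact/measurable_EFinP.
Qed.

End weighted_pushforward.

(* The measure is abstract because [normal_prob] and [distribution] live on different (although
   convertible) measurable structures of [R]. *)
Lemma normal_mgf (R : realType) (nu : {measure set R -> \bar R}) (a : R) :
  (forall A : set R, measurable A -> nu A = normal_prob 0 1 A) ->
  (\int[nu]_x (expR (a * x))%:E = (expR (a ^+ 2 / 2))%:E)%E.
Proof.
move=> nuE.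
have mexp (b : R) : measurable_fun [set: R] (fun x : R => expR (b * x)).
  by apply: measurableT_comp => //; exact: measurable_funM.
have mu1 : 1 != 0 :> R by [].
have mid : measurable_fun [set: measurableTypeR R] (id : measurableTypeR R -> R).
  by move=> _ A mA; rewrite setTI.
have := @ge0_integral_weighted_pushforward _ _ _ _ R lebesgue_measure
  nu (normal_pdf 0 1) id 1 (measurable_normal_pdf 0 1)
  (normal_pdf_ge0 0 1) mid _ (fun x => expR (a * x))
  (mexp a) (fun x => expR_ge0 _).
rewrite mul1e => <-; last first.
  move=> A mA; rewrite mul1e nuE// /normal_prob [RHS]integral_mkcond; apply: eq_integral => x _.
  by rewrite epatch_indic.
transitivity (\int[lebesgue_measure]_x ((expR (a ^+ 2 / 2))%:E * (normal_pdf a 1 x)%:E))%E.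
  apply: eq_integral => x _; rewrite -EFinM; congr (_%:E).
  rewrite !normal_pdfE// mulrCA -mulrA; congr (_ * _).
  by rewrite /normal_fun -!expRD; congr expR; field.
rewrite ge0_integralZl_EFin//.
- by rewrite integral_normal_pdf mule1.
- by move=> x _; rewrite lee_fin normal_pdf_ge0.
- by apply/measurable_EFinP; exact: measurable_normal_pdf.
Qed.

Section independent_variables.
Context d (T : measurableType d) (R : realType) (P : probability T R).

(** Independence is a statement about events. The mixed product, functions over [r1] and indicators
    over [r2], is the invariant that lets the indicators be replaced one index at a time. *)
Lemma indep_expectation_prod (I : choiceType) (D : set I) (X : I -> {RV P >-> R})
    (f : I -> R -> R) (m : I -> R) :
  mutually_independent D X ->
  (forall i, measurable_fun setT (f i)) -> (forall i x, 0 <= f i x) ->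
  (forall i, D i -> (\int[P]_w (f i (X i w))%:E = (m i)%:E)%E) ->
  forall (r1 r2 : seq I) (A : I -> set R),
    uniq (r1 ++ r2) -> [set` r1 ++ r2] `<=` D -> (forall i, measurable (A i)) ->
    (\int[P]_w ((\prod_(i <- r1) f i (X i w)) * \prod_(i <- r2) \1_(A i) (X i w))%:E =
     ((\prod_(i <- r1) m i) * \prod_(i <- r2) fine (P (X i @^-1` A i)))%:E)%E.
Proof.
move=> indep mf f_ge0 fm.
have mX i : measurable_fun setT (X i) by exact: measurable_funP.
have mXA i B : measurable B -> measurable (X i @^-1` B).
  by move=> mB; rewrite -[_ @^-1` _]setTI; exact: mX.
have mind i (B : set R) : measurable B -> measurable_fun setT (fun w => \1_B (X i w) : R).
  move=> mB; have mB' : measurable_fun setT (\1_B : R -> R) by exact: measurable_indic.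
  exact: measurableT_comp mB' (mX i).
have mprod (r : seq I) (F : I -> T -> R) :
    (forall i, measurable_fun setT (F i)) -> measurable_fun setT (fun w => \prod_(i <- r) F i w).
  move=> mF; elim: r => [|i r IH].
    by under eq_fun do rewrite big_nil; exact: measurable_cst.
  by under eq_fun do rewrite big_cons; exact: measurable_funM.
elim=> [|i r1 IH] r2 A r_uniq rD mA.
  rewrite big_nil mul1r; under eq_integral do rewrite big_nil mul1r.
  have indE w : \prod_(i <- r2) (\1_(A i) (X i w) : R) =
                  \1_(\bigcap_(i in [set` r2]) (X i @^-1` A i)) w.
    rewrite [RHS]indicE; have [wA|/existsNP[i /not_implyP[ir2 wA]]] :=
      pselect (forall i, i \in r2 -> A i (X i w)).
      rewrite mem_set => [|i /= ir2]; last exact: wA.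
      by apply: big1_seq => i /andP[_ ir2]; rewrite indicE mem_set//; exact: wA.
    rewrite memNset => [|h]; last exact/wA/h.
    by rewrite (bigD1_seq i)//= indicE memNset// mul0r.
  under eq_integral do rewrite indE.
  rewrite integral_indic//; last first.
    apply: fin_bigcap_measurable => [|i _]; first exact: finite_seq.
    exact: mXA.
  rewrite setIT [LHS](indep r2 A r_uniq rD mA) -prodEFin; apply: eq_bigr => i _.
  by rewrite fineK// fin_num_measure//; exact: mXA.
have ir : i \notin r1 ++ r2 by case/andP: r_uniq.
have ir2 : i \notin r2 by move: ir; rewrite mem_cat => /norP[].
pose Z w := (\prod_(j <- r1) f j (X j w)) * \prod_(j <- r2) \1_(A j) (X j w).
pose c := (\prod_(j <- r1) m j) * \prod_(j <- r2) fine (P (X j @^-1` A j)).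
have mZ : measurable_fun setT Z.
  apply: measurable_funM; apply: mprod => j; last exact: mind.
  exact: measurableT_comp (mf j) (mX j).
have Z_ge0 w : 0 <= Z w.
  by apply: mulr_ge0; apply: prodr_ge0 => j _ //; rewrite indicE.
have Z_indic B : measurable B ->
    (\int[P]_w (Z w * \1_B (X i w))%:E = c%:E * distribution P (X i) B)%E.
  move=> mB; pose A' j := if j == i then B else A j.
  have A'E (g : I -> set R -> R) :
      \prod_(j <- i :: r2) g j (A' j) = g i B * \prod_(j <- r2) g j (A j).
    rewrite big_cons /A' eqxx; congr (_ * _); apply: eq_big_seq => j jr2.
    by case: eqP => // ji; move: ir2; rewrite -ji jr2.
  have := IH (i :: r2) A'; rewrite (A'E (fun j S => fine (P (X j @^-1` S)))).
  under eq_integral do rewrite (A'E (fun j S => \1_S (X j _))) mulrCA mulrC.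
  move=> ->.
  - rewrite mulrCA mulrC EFinM -/c fineK// fin_num_measure//; exact: mXA.
  - by rewrite -cat1s uniq_catCA.
  - by move=> j /= jr; apply: rD => /=; move: jr; rewrite !(mem_cat, inE) orbCA.
  - by move=> j; rewrite /A'; case: ifP.
have := @ge0_integral_weighted_pushforward _ _ _ _ R P (distribution P (X i)) Z (X i) c
  mZ Z_ge0 (mX i) Z_indic (f i) (mf i) (f_ge0 i).
rewrite ge0_integral_distribution; [|exact/measurable_EFinP|by move=> y; rewrite lee_fin].
rewrite fm; last by apply: rD => /=; rewrite inE eqxx.
move=> ZfE; transitivity (\int[P]_w (Z w * f i (X i w))%:E)%E.
  by apply: eq_integral => w _; rewrite big_cons /Z; congr (_%:E); ring.
by rewrite ZfE -EFinM big_cons /c; congr (_%:E); ring.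
Qed.

End independent_variables.

Section gaussian_tail.
Context d (T : measurableType d) (R : realType) (P : probability T R).
Variable g : seq nat -> {RV P >-> R}.
Hypothesis g_gauss : gaussian_couplings g.

Lemma gaussian_coupling_mgf (t : seq nat) (a : R) : (2 <= size t)%N -> uniq t ->
  (\int[P]_w (expR (a * g t w))%:E = (expR (a ^+ 2 / 2))%:E)%E.
Proof.
move=> t2 t_uniq; have [g1 _ _] := g_gauss.
rewrite -(@normal_mgf R (distribution P (g t))); last by move=> A; exact: g1.
rewrite ge0_integral_distribution//.
  apply/measurable_EFinP; apply: measurableT_comp => //; exact: measurable_funM.

Qed.

Lemma measurable_gaussian_sum (r : seq (seq nat)) (a : seq nat -> R) :
  measurable_fun setT (fun w => \sum_(t <- r) a t * g t w).
Proof.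
apply: measurable_sum => t; apply: measurable_funM => //.
Qed.

Lemma gaussian_sum_mgf (r : seq (seq nat)) (a : seq nat -> R) :
  uniq r -> {in r, forall t, (2 <= size t)%N && uniq t} ->
  (\int[P]_w (expR (\sum_(t <- r) a t * g t w))%:E =
   (expR ((\sum_(t <- r) a t ^+ 2) / 2))%:E)%E.
Proof.
move=> r_uniq rD; have [_ indep _] := g_gauss.
pose f t x := expR (a t * x); pose m t := expR (a t ^+ 2 / 2).
have mf t : measurable_fun setT (f t).
  by apply: measurableT_comp => //; exact: measurable_funM.
have fm t : ((2 <= size t)%N && uniq t) -> (\int[P]_w (f t (g t w))%:E = (m t)%:E)%E.
  by case/andP => t2 tu; exact: gaussian_coupling_mgf.
have r0_uniq : uniq (r ++ [::]) by rewrite cats0.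
have r0D : [set` r ++ [::]] `<=` [set t | (2 <= size t)%N && uniq t].
  by move=> t /=; rewrite cats0 => /rD.
have := indep_expectation_prod indep mf (fun t x => expR_ge0 _) fm
  r0_uniq r0D (fun=> measurableT).
under eq_integral do rewrite big_nil mulr1 -expR_sum.
by rewrite big_nil mulr1 -expR_sum mulr_suml.
Qed.

Lemma gaussian_sum_tail (r : seq (seq nat)) (a : seq nat -> R) (u v : R) :
  uniq r -> {in r, forall t, (2 <= size t)%N && uniq t} ->
  0 <= u -> 0 < v -> \sum_(t <- r) a t ^+ 2 <= v ->
  (P [set w | (u < \sum_(t <- r) a t * g t w)%R]
     <= (expR (- (u ^+ 2 / (2 * v))))%:E)%E.
Proof.
move=> r_uniq rD u0 v0 av.
set S := fun w => \sum_(t <- r) a t * g t w.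
have mS : measurable_fun setT S := measurable_gaussian_sum r a.
have mA : measurable [set w | u < S w].
  rewrite -[X in measurable X]setTI; have := mS measurableT `]u, +oo[%classic (measurable_itv _).
  rewrite (_ : S @^-1` _ = [set w | u < S w])//.
  by apply/seteqP; split => w /=; rewrite in_itv /= andbT.
(* The optimal Chernoff parameter for variance v. *)
pose l := u / v.
have mgf : (\int[P]_w (expR (l * S w))%:E = (expR (l ^+ 2 * (\sum_(t <- r) a t ^+ 2) / 2))%:E)%E.
  transitivity (\int[P]_w (expR (\sum_(t <- r) (l * a t) * g t w))%:E)%E.
    apply: eq_integral => w _; rewrite /S mulr_sumr; congr (expR _)%:E.
    by apply: eq_bigr => t _; rewrite mulrA.
  rewrite (gaussian_sum_mgf (fun t => l * a t) r_uniq rD).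
  under eq_bigr do rewrite exprMn.
  by rewrite -mulr_sumr.
rewrite -[X in P X]setIT -integral_indic//.
apply: (@le_trans _ _ (\int[P]_w ((expR (- (l * u)))%:E * (expR (l * S w))%:E))%E).
  apply: ge0_le_integral => //.
  - apply/measurable_EFinP; exact: measurable_indic.
  - apply/measurable_EFinP; apply: measurable_funM => //; apply: measurableT_comp => //.
    exact: measurable_funM.
  - move=> w _; rewrite lee_fin indicE -expRD.
    have [/set_mem /= uS|_] := boolP (w \in _); last exact: expR_ge0.
    rewrite -[leLHS](expR0 R) ler_expR addrC -mulrBr; apply: mulr_ge0.
      by rewrite divr_ge0// ltW.
    by rewrite subr_ge0 ltW.
rewrite ge0_integralZl_EFin ?expR_ge0//; last first.
  apply/measurable_EFinP; apply: measurableT_comp => //; exact: measurable_funM.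
rewrite mgf -EFinM lee_fin -expRD ler_expR.
have : l ^+ 2 * (\sum_(t <- r) a t ^+ 2) / 2 <= l ^+ 2 * v / 2.
  by rewrite ler_wpM2r// ler_wpM2l// sqr_ge0.
have -> : u ^+ 2 / (2 * v) = l * u - l ^+ 2 * v / 2 by rewrite /l; field; rewrite gt_eqF.
lra.
Qed.

End gaussian_tail.

(** * Integer vectors as a substitute for nets *)

Section integer_vectors.
Context {R : realType} (N : nat).

(* Signs and absolute values of the entries; the bound [2 N] is implied by [short]. *)
Definition int_vector := {ffun 'I_N -> bool * 'I_(2 * N).+1}.

Definition entry (z : int_vector) (i : 'I_N) : R := (-1) ^+ (z i).1 * (z i).2%:R.

Definition short (z : int_vector) := \sum_i entry z i ^+ 2 <= 4 * N%:R.

Lemma entry_sqr z i : entry z i ^+ 2 = ((z i).2 ^ 2)%:R.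
Proof. by rewrite /entry exprMn sqrr_sign mul1r natrX. Qed.

(** Exponential Markov bound: the weights 2^(- k^2) sum to at most 4 per coordinate, and 2^4 * 4 =
    64. A zero entry is counted with both signs. *)
Lemma short_vectors_count : \sum_(z | short z) 1 <= 64 ^+ N :> R.
Proof.
have half_sum n : \sum_(k < n) (2^-1 : R) ^+ k <= 2.
  have : \sum_(k < n) (2^-1 : R) ^+ k + 2 * 2^-1 ^+ n = 2.
    elim: n => [|n IH]; first by rewrite big_ord0 expr0; lra.
    by rewrite big_ord_recr /= -[RHS]IH exprS; lra.
  have : 0 <= (2^-1 : R) ^+ n by rewrite exprn_ge0// invr_ge0.
  lra.
have entry_sum : \sum_(e : bool * 'I_(2 * N).+1) (2^-1 : R) ^+ (e.2 ^ 2) <= 4.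
  rewrite -(pair_big xpredT xpredT (fun (b : bool) (k : 'I_(2 * N).+1) => (2^-1 : R) ^+ (k ^ 2)))/=.
  have h : \sum_(k < (2 * N).+1) (2^-1 : R) ^+ (k ^ 2) <= 2.
    apply: le_trans (half_sum (2 * N).+1); apply: ler_sum => k _.
    apply: ler_wiXn2l; rewrite ?invr_ge0 ?invf_le1 ?ler1n//.
    by rewrite -mulnn; case: (k : nat) => // m; exact: leq_pmulr.
  by rewrite big_bool /=; lra.
(* The indicator of a short vector is at most [2 ^ (4 N - sum of the squared entries)]. *)
apply: le_trans (_ : \sum_(z : int_vector) (2 ^+ 4) ^+ N *
  \prod_i (2^-1 : R) ^+ ((z i).2 ^ 2) <= _).
  rewrite big_mkcond /=; apply: ler_sum => z _; case: ifPn => [z_short|_]; last first.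
    by rewrite mulr_ge0 ?exprn_ge0// prodr_ge0// => i _; rewrite exprn_ge0// invr_ge0.
  have e_le : (\sum_i (z i).2 ^ 2 <= 4 * N)%N.
    rewrite -(ler_nat R) natr_sum natrM; apply: le_trans z_short.
    by apply: ler_sum => i _; rewrite entry_sqr.
  rewrite -expr_sum -exprM exprVn ler_pdivlMr ?exprn_gt0// mul1r.
  by rewrite ler_weXn2l// ler1n.
rewrite -mulr_sumr -(bigA_distr_bigA (fun _ (e : bool * 'I_(2 * N).+1) => (2^-1 : R) ^+ (e.2 ^ 2))).
rewrite prodr_const card_ord -exprMn; apply: lerXn2r; rewrite ?nnegrE ?mulr_ge0 ?exprn_ge0//.
  by apply: sumr_ge0 => e _; rewrite exprn_ge0// invr_ge0.
lra.
Qed.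

(* Every point of the ball of radius [sqrt N] is a convex combination of short integer vectors:
   round each coordinate away from or towards [0], according to the sign of [c i * y i]. *)
Lemma rounding (c y : 'I_N -> R) : \sum_i y i ^+ 2 <= N%:R ->
  exists2 z, short z & \sum_i c i * y i <= \sum_i c i * entry z i.
Proof.
move=> y_le.
have y_entry i : `|y i| <= N%:R.
  have N0 : (0 < N)%N := leq_ltn_trans (leq0n i) (ltn_ord i).
  apply: le_of_sqr_le => //; rewrite real_normK ?num_real//.
  apply: le_trans (_ : N%:R <= _).
    by apply: le_trans y_le; rewrite (bigD1 i)//= lerDl sumr_ge0// => j _; exact: sqr_ge0.
  by rewrite -natrX ler_nat -mulnn leq_pmulr.
(* Increasing |y i| increases c i * y i exactly when that product is positive. As k <= |y| + 1, the
   squared length is at most 2 N + 2 N. *)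
pose k i := (Num.trunc `|y i| + (0 < c i * y i)%R)%N.
have k_le i : (k i < (2 * N).+1)%N.
  have : (Num.trunc `|y i| <= N)%N.
    by rewrite truncn_le_nat; apply: le_lt_trans (y_entry i) _; rewrite ltr_nat.
  have N0 : (0 < N)%N := leq_ltn_trans (leq0n i) (ltn_ord i).
  rewrite /k ltnS mul2n -addnn => h; apply: leq_add => //.
  by apply: leq_trans (leq_b1 _) N0.
exists [ffun i => ((y i < 0)%R, Ordinal (k_le i))].
  apply: le_trans (_ : \sum_(i < N) (2 * y i ^+ 2 + 2) <= _).
    apply: ler_sum => i _; rewrite entry_sqr ffunE /= natrX.
    have kn : (k i)%:R <= `|y i| + 1 :> R.
      rewrite natrD; apply: lerD; first by rewrite truncn_le.
      by case: (0 < _).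
    apply: le_trans (_ : (`|y i| + 1) ^+ 2 <= _).
      by apply: lerXn2r; rewrite ?nnegrE ?addr_ge0.
    by rewrite -(real_normK (num_real (y i))); have := sqr_ge0 (`|y i| - 1); nra.
  by rewrite big_split /= -mulr_sumr sumr_const card_ord -mulr_natr; lra.
apply: ler_sum => i _; rewrite /entry ffunE /=.
have yE : y i = (-1) ^+ (y i < 0)%R * `|y i|.
  have [h|h] := ltrP (y i) 0; first by rewrite expr1 mulN1r ltr0_norm// opprK.
  by rewrite expr0 mul1r ger0_norm.
have t1 : (Num.trunc `|y i|)%:R <= `|y i| by rewrite truncn_le.
have t2 : `|y i| < (Num.trunc `|y i|).+1%:R := truncnS_gt _.
rewrite {1}yE !mulrA.
have {yE} : c i * y i = c i * (-1) ^+ (y i < 0)%R * `|y i| by rewrite -mulrA -yE.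
rewrite /k => ->; move: (c i * _) => a; move: `|y i| (normr_ge0 (y i)) t1 t2 => b b0 t1 t2.
have [ab|ab] := ltrP 0 (a * b).
  have a0 : 0 < a by rewrite ltNge; apply/negP => a0; move: ab; rewrite ltNge mulr_le0_ge0.
  by rewrite addn1 ler_wpM2l// ltW.
rewrite addn0; have [a0|a0] := leP a 0; first by rewrite ler_wnM2l.
have -> : b = 0 by apply/eqP; rewrite eq_le b0 andbT -(pmulr_rle0 _ a0).
by rewrite truncn0.
Qed.

(** Scale both vectors to the sphere of radius sqrt N and round them in turn; the form is linear in
    each, so rounding never decreases it. *)
Lemma bilinear_norm_le (G : 'I_N -> 'I_N -> R) (delta : R) : 0 <= delta ->
  (forall z z', short z -> short z' ->
     \sum_i \sum_j entry z i * G i j * entry z' j <= delta * N%:R) ->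
  forall x y : 'I_N -> R,
    (\sum_i \sum_j x i * G i j * y j) ^+ 2
    <= delta ^+ 2 * (\sum_i x i ^+ 2) * (\sum_i y i ^+ 2).
Proof.
move=> delta0 short_le x y.
pose B (u v : 'I_N -> R) := \sum_i \sum_j u i * G i j * v j.
have Bl u v : B u v = \sum_i (\sum_j G i j * v j) * u i.
  apply: eq_bigr => i _; rewrite mulr_suml; apply: eq_bigr => j _; ring.
have Br u v : B u v = \sum_j (\sum_i u i * G i j) * v j.
  by rewrite /B exchange_big; apply: eq_bigr => j _; rewrite mulr_suml.
have ball u v : \sum_i u i ^+ 2 <= N%:R -> \sum_i v i ^+ 2 <= N%:R -> B u v <= delta * N%:R.
  move=> u_le v_le; rewrite Bl.
  have [z z_short /le_trans] := rounding (fun i => \sum_j G i j * v j) u_le; apply.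
  rewrite -Bl Br.
  have [z' z'_short /le_trans] := rounding (fun j => \sum_i entry z i * G i j) v_le; apply.
  by rewrite -Br; exact: short_le.
have BZ a b u v : B (fun i => a * u i) (fun j => b * v j) = a * b * B u v.
  rewrite /B mulr_sumr; apply: eq_bigr => i _; rewrite mulr_sumr; apply: eq_bigr => j _; ring.
have sq0 (u : 'I_N -> R) : 0 <= \sum_i u i ^+ 2.
  by apply: sumr_ge0 => i _; exact: sqr_ge0.
have sq_eq0 (u : 'I_N -> R) : \sum_i u i ^+ 2 = 0 -> forall i, u i = 0.
  move=> /eqP; rewrite psumr_eq0 => [/allP h i|i _]; last exact: sqr_ge0.
  by apply/eqP; rewrite -sqrf_eq0; apply: h; rewrite mem_index_enum.
rewrite -/(B x y); set X := \sum_i x i ^+ 2; set Y := \sum_i y i ^+ 2.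
have [X0|X0] := eqVneq X 0.
  rewrite /B big1 ?expr0n /= ?mulr_ge0 ?sqr_ge0 ?sq0// => i _.
  by rewrite big1// => j _; rewrite (sq_eq0 x)// !mul0r.
have [Y0|Y0] := eqVneq Y 0.
  rewrite /B big1 ?expr0n /= ?mulr_ge0 ?sqr_ge0 ?sq0// => i _.
  by rewrite big1// => j _; rewrite (sq_eq0 y)// mulr0.
have X_gt0 : 0 < X by rewrite lt0r X0 sq0.
have Y_gt0 : 0 < Y by rewrite lt0r Y0 sq0.
have N_gt0 : 0 < N%:R :> R.
  rewrite ltr0n lt0n; apply/eqP => N0; move: X0; rewrite /X big1 ?eqxx// => i.
  by have := ltn_ord i; rewrite {2}N0.
pose a := Num.sqrt (N%:R / X); pose b := Num.sqrt (N%:R / Y).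
have a2 : a ^+ 2 = N%:R / X by rewrite sqr_sqrtr// divr_ge0// ltW.
have b2 : b ^+ 2 = N%:R / Y by rewrite sqr_sqrtr// divr_ge0// ltW.
have scaled e : e ^+ 2 = 1 -> e * (a * b * B x y) <= delta * N%:R.
  move=> e2; have -> : e * (a * b * B x y) = B (fun i => e * a * x i) (fun j => b * y j).
    by rewrite BZ; ring.
  apply: ball.
    under eq_bigr do rewrite !exprMn; rewrite -mulr_sumr e2 mul1r a2 -/X.
    by rewrite divfK.
  under eq_bigr do rewrite exprMn; rewrite -mulr_sumr b2 -/Y.
  by rewrite divfK.
have : (a * b * B x y) ^+ 2 <= (delta * N%:R) ^+ 2.
  rewrite -(real_normK (num_real (a * b * B x y))); apply: lerXn2r; rewrite ?nnegrE ?mulr_ge0//.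
  have s1 := scaled 1 (expr1n _ _); have m1 : (-1 : R) ^+ 2 = 1 by rewrite sqrrN expr1n.
  have s2 := scaled (-1) m1; rewrite mul1r in s1; rewrite mulN1r in s2.
  by rewrite ler_norml s1 andbT lerNl.
rewrite !exprMn a2 b2.
rewrite (_ : N%:R / X * (N%:R / Y) * B x y ^+ 2 = B x y ^+ 2 * (N%:R ^+ 2 / (X * Y))); last first.
  by field; rewrite X0 Y0.
rewrite -ler_pdivlMr; last by rewrite divr_gt0 ?exprn_gt0 ?mulr_gt0.
move/le_trans; apply; rewrite le_eqVlt; apply/orP; left; apply/eqP; field.
by rewrite X0 Y0 gt_eqF.
Qed.

End integer_vectors.

(** Only the left argument is centered in the hypothesis. By symmetry the mean of x contributes the
    same form at (y, 1), so two terms of norm delta remain besides the mean entry w = S / N^2. *)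
Lemma near_flat_of_projection {R : realType} (N : nat) (J : 'I_N -> 'I_N -> R) (delta : R)
    (S := \sum_i \sum_j J i j) : (0 < N)%N -> 0 <= delta ->
  (forall i j, J i j = J j i) ->
  S <= 2 * delta * N%:R * Num.sqrt N%:R -> - S <= 2 * delta * N%:R * Num.sqrt N%:R ->
  (forall x y : 'I_N -> R,
    (\sum_i \sum_j x i * (J i j - (\sum_l J l j) / N%:R) * y j) ^+ 2
    <= delta ^+ 2 * (\sum_i x i ^+ 2) * (\sum_i y i ^+ 2)) ->
  near_flat (2 * delta) (S / N%:R ^+ 2) J.
Proof.
move=> N_gt0 delta0 Jsym S_le S_ge proj.
have N0 : 0 < N%:R :> R by rewrite ltr0n.
split=> // [x y|]; last first.
  have S2 : S ^+ 2 <= (2 * delta * N%:R * Num.sqrt N%:R) ^+ 2.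
    rewrite -(real_normK (num_real S)); apply: lerXn2r; rewrite ?nnegrE ?mulr_ge0 ?sqrtr_ge0//.
    by rewrite ler_norml S_le andbT lerNl.
  rewrite expr_div_n mulrAC ler_pdivrMr ?exprn_gt0//.
  apply: le_trans (ler_wpM2r (ltW N0) S2) _.
  by rewrite exprMn sqr_sqrtr// le_eqVlt; apply/orP; left; apply/eqP; ring.
pose B (u v : 'I_N -> R) := \sum_i \sum_j u i * (J i j - (\sum_l J l j) / N%:R) * v j.
set X := \sum_i x i; set Y := \sum_i y i.
have BE u v : B u v = \sum_i \sum_j u i * J i j * v j
    - (\sum_i u i) / N%:R * \sum_j (\sum_l J l j) * v j.
  have -> : (\sum_i u i) / N%:R * \sum_j (\sum_l J l j) * v j =
      \sum_i \sum_j u i * ((\sum_l J l j) / N%:R) * v j.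
    rewrite 2!mulr_suml; apply: eq_bigr => i _; rewrite mulr_sumr; apply: eq_bigr => j _; ring.
  rewrite -sumrB; apply: eq_bigr => i _; rewrite -sumrB; apply: eq_bigr => j _; ring.
have B1 : B y (fun=> 1) = \sum_j (\sum_l J l j) * y j - Y / N%:R * S.
  rewrite BE; congr (_ - _); last first.
    by congr (_ * _); rewrite /S exchange_big; apply: eq_bigr => j _; rewrite mulr1.
  apply: eq_bigr => i _; rewrite mulr_suml; apply: eq_bigr => j _; rewrite Jsym; ring.
have -> : \sum_i \sum_j x i * J i j * y j - S / N%:R ^+ 2 * X * Y =
    B x y + X / N%:R * B y (fun=> 1).
  by rewrite B1 BE -/X; field; rewrite gt_eqF.
have h1 := proj x y; have h2 := proj y (fun=> 1); rewrite -!/(B _ _) in h1 h2.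
have X2 : X ^+ 2 <= N%:R * \sum_i x i ^+ 2 := sqr_sum_le x.
have sq0 (u : 'I_N -> R) : 0 <= \sum_i u i ^+ 2.
  by apply: sumr_ge0 => i _; exact: sqr_ge0.
rewrite expr1n sumr_const card_ord in h2.
have h3 : (X / N%:R * B y (fun=> 1)) ^+ 2 <= delta ^+ 2 * (\sum_i x i ^+ 2) * (\sum_i y i ^+ 2).
  rewrite exprMn; apply: le_trans (_ : ((\sum_i x i ^+ 2) / N%:R) *
     (delta ^+ 2 * (\sum_i y i ^+ 2) * N%:R) <= _).
    apply: ler_pM (sqr_ge0 _) (sqr_ge0 _) _ h2.
    rewrite expr_div_n ler_pdivrMr ?exprn_gt0//; apply: le_trans X2 _.
    by rewrite le_eqVlt; apply/orP; left; apply/eqP; field; rewrite gt_eqF.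
  by rewrite le_eqVlt; apply/orP; left; apply/eqP; field; rewrite gt_eqF.
have := sqr_ge0 (B x y - X / N%:R * B y (fun=> 1)).
move: h1 h3; move: (B x y) (X / N%:R * _) (\sum_i x i ^+ 2) (\sum_i y i ^+ 2) => b c x2 y2; nra.
Qed.

(** * Sums over tuples *)

Section tuple_sums.
Context {R : realFieldType} (N : nat).
Implicit Types (x y : 'I_N -> R).

Lemma sum_tuple_prod (p : nat) (G : 'I_p -> 'I_N -> R) :
  \sum_(t : p.-tuple 'I_N) \prod_(c < p) G c (tnth t c) = \prod_(c < p) \sum_i G c i.
Proof.
rewrite bigA_distr_bigA (reindex (@tuple_of_finfun 'I_N p)) /=.
  apply: eq_bigr => f _; apply: eq_bigr => c _; congr (G c _).
  by rewrite tnth_mktuple.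
apply: onW_bij; exists (@finfun_of_tuple 'I_N p); first exact: tuple_of_finfunK.
exact: finfun_of_tupleK.
Qed.

(** Each position other than a and b contributes N; the factor N^2 on the left avoids the exponent p
    - 2. *)
Lemma sum_tuple_pair (p : nat) (u v : 'I_N -> R) (a b : 'I_p) : a != b ->
  N%:R ^+ 2 * \sum_(t : p.-tuple 'I_N) u (tnth t a) * v (tnth t b) =
  N%:R ^+ p * (\sum_i u i) * (\sum_i v i).
Proof.
move=> ab; pose G (c : 'I_p) i := if c == a then u i else if c == b then v i else 1.
have -> : \sum_(t : p.-tuple 'I_N) u (tnth t a) * v (tnth t b) =
          \sum_(t : p.-tuple 'I_N) \prod_(c < p) G c (tnth t c).
  apply: eq_bigr => t _; rewrite (bigD1 a)//= (bigD1 b) 1?eq_sym//= /G !eqxx eq_sym (negbTE ab).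
  by rewrite big1 ?mulr1// => c /andP[/negbTE -> /negbTE ->].
rewrite sum_tuple_prod (bigD1 a)//= (bigD1 b) 1?eq_sym//= /G !eqxx eq_sym (negbTE ab).
rewrite [X in _ * (_ * (_ * X))](eq_bigr (fun=> N%:R)) =>
  [|c /andP[/negbTE -> /negbTE ->]]; last first.
  by rewrite sumr_const card_ord.
rewrite prodr_const.
have p2 : (2 <= p)%N.
  by have := max_card (pred2 a b); rewrite card2 ab card_ord.
have -> : #|[pred c | c != a & c != b]| = (p - 2)%N.
  have := cardC (pred2 a b); rewrite card2 ab card_ord => h.
  apply/eqP; rewrite -(eqn_add2l 2) subnKC// -[X in _ == X]h eqn_add2l; apply/eqP.
  by apply: eq_card => c; rewrite !inE negb_or.
by rewrite -[in RHS](subnKC p2) exprD; ring.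
Qed.

Lemma sum_tuple_triple0 (p : nat) (u x : 'I_N -> R) (a a' b : 'I_p) :
  \sum_i x i = 0 -> a != b -> a' != b -> a != a' ->
  \sum_(t : p.-tuple 'I_N) u (tnth t b) * (x (tnth t a) * x (tnth t a')) = 0.
Proof.
move=> x0 ab a'b aa'.
pose G (c : 'I_p) i := if c == b then u i else if (c == a) || (c == a') then x i else 1.
transitivity (\sum_(t : p.-tuple 'I_N) \prod_(c < p) G c (tnth t c)).
  apply: eq_bigr => t _; rewrite (bigD1 b)//= (bigD1 a)//= (bigD1 a')/=; last first.
    by rewrite a'b eq_sym.
  rewrite /G !eqxx (negbTE ab) (negbTE a'b) /= eq_sym (negbTE aa') /=.
  by rewrite big1 ?mulr1// => c /andP[/andP[/negbTE -> /negbTE ->] /negbTE ->].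
by rewrite sum_tuple_prod (bigD1 a)//= /G (negbTE ab) eqxx /= x0 mul0r.
Qed.

(** Pairs of distinct positions rather than of distinct values, so that sums over all tuples
    factorize over positions. *)
Definition position_pairs (p : nat) x y (t : p.-tuple 'I_N) : R :=
  \sum_(b < p) (\sum_(a < p | a != b) x (tnth t a)) * y (tnth t b).

(* When [x] sums to zero, the cross terms of the square vanish after summation over *all* tuples;
   this is what brings the naive factor [p ^ 4] down to [p ^ 3]. *)
Lemma sum_position_pairs_sqr (p : nat) x y : \sum_i x i = 0 ->
  N%:R ^+ 2 * \sum_(t : p.-tuple 'I_N) position_pairs x y t ^+ 2 <=
  p%:R ^+ 3 * N%:R ^+ p * (\sum_i x i ^+ 2) * (\sum_i y i ^+ 2).
Proof.
move=> x0; set X := \sum_i x i ^+ 2; set Y := \sum_i y i ^+ 2.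
have X0 : 0 <= X by apply: sumr_ge0 => i _; exact: sqr_ge0.
have Y0 : 0 <= Y by apply: sumr_ge0 => i _; exact: sqr_ge0.
have inner (b : 'I_p) : N%:R ^+ 2 * \sum_(t : p.-tuple 'I_N)
    (\sum_(a < p | a != b) x (tnth t a)) ^+ 2 * y (tnth t b) ^+ 2 <= p%:R * (N%:R ^+ p * X * Y).
  have -> : \sum_(t : p.-tuple 'I_N)
      (\sum_(a < p | a != b) x (tnth t a)) ^+ 2 * y (tnth t b) ^+ 2 =
      \sum_(a < p | a != b) \sum_(t : p.-tuple 'I_N) x (tnth t a) ^+ 2 * y (tnth t b) ^+ 2.
    transitivity (\sum_(t : p.-tuple 'I_N) \sum_(a < p | a != b) \sum_(a' < p | a' != b)
        y (tnth t b) ^+ 2 * (x (tnth t a) * x (tnth t a'))).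
      apply: eq_bigr => t _; rewrite expr2 !mulr_suml; apply: eq_bigr => a _.
      by rewrite mulr_sumr mulr_suml; apply: eq_bigr => a' _; ring.
    rewrite exchange_big /=; apply: eq_bigr => a ab.
    rewrite exchange_big /= (bigD1 a)//= [X in _ + X]big1 ?addr0 => [|a' /andP[a'b a'a]].
      by apply: eq_bigr => t _; ring.
    by apply: (sum_tuple_triple0 (fun i => y i ^+ 2)) => //; rewrite eq_sym.
  rewrite mulr_sumr (eq_bigr (fun=> N%:R ^+ p * X * Y)) => [|a ab]; last first.
    by rewrite (sum_tuple_pair (fun i => x i ^+ 2) (fun i => y i ^+ 2) ab).
  rewrite sumr_const [leRHS]mulr_natl; apply: ler_wpMn2l.
    by rewrite !mulr_ge0 ?exprn_ge0.
  by apply: leq_trans (max_card _) _; rewrite card_ord.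
(* One factor p is from Cauchy-Schwarz over b, one from the sum over b, and one from the diagonal
   terms over a. *)
apply: le_trans (_ : N%:R ^+ 2 * \sum_(t : p.-tuple 'I_N) p%:R * \sum_(b < p)
    (\sum_(a < p | a != b) x (tnth t a)) ^+ 2 * y (tnth t b) ^+ 2 <= _).
  apply: ler_wpM2l; first by rewrite exprn_ge0.
  apply: ler_sum => t _; apply: le_trans (sqr_sum_le _) _.
  by under eq_bigr do rewrite exprMn.
rewrite -mulr_sumr exchange_big /= mulrCA mulr_sumr.
apply: le_trans (_ : p%:R * \sum_(b < p) p%:R * (N%:R ^+ p * X * Y) <= _).
  by rewrite ler_wpM2l//; apply: ler_sum => b _; exact: inner.
rewrite sumr_const card_ord -[_ *+ p]mulr_natl.
by rewrite le_eqVlt; apply/orP; left; apply/eqP; ring.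
Qed.

(** For [t] without repetitions, the Hessian form at (x, y) of the monomial indexed by [t], divided
    by that monomial. *)
Definition pairs x y (t : seq 'I_N) : R :=
  \sum_(j <- t) (\sum_(i <- t | i != j) x i) * y j.

Lemma pairs_tuple (p : nat) x y (t : p.-tuple 'I_N) : uniq t ->
  pairs x y t = position_pairs x y t.
Proof.
move=> t_uniq; rewrite /pairs /position_pairs big_tuple; apply: eq_bigr => b _.
congr (_ * _); rewrite big_tuple; apply: eq_bigl => a.
by rewrite (inj_eq (elimT (tuple_uniqP _) t_uniq)).
Qed.

Lemma pairs_uniq x y (t : seq 'I_N) : uniq t ->
  pairs x y t = \sum_i \sum_j (if i == j then 0 else (i \in t)%:R * (j \in t)%:R * (x i * y j)).
Proof.
move=> t_uniq; rewrite /pairs exchange_big /= big_uniq// big_mkcond /=; apply: eq_bigr => j _.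
case: (boolP (j \in t)) => jt; last first.
  by rewrite big1// => i _; case: eqP => // _; rewrite mulr0 mul0r.
rewrite -big_filter big_uniq ?filter_uniq// mulr_suml big_mkcond /=; apply: eq_bigr => i _.
by rewrite mem_filter; case: eqP => //= _; case: (i \in t); rewrite ?mulr1 ?mul1r ?mul0r.
Qed.

Lemma pairs_cst1 (t : seq 'I_N) : 0 <= pairs (fun=> 1) (fun=> 1) t <= (size t)%:R ^+ 2.
Proof.
rewrite /pairs; apply/andP; split.
  by apply: sumr_ge0 => j _; rewrite mulr1; exact: sumr_ge0.
apply: le_trans (_ : \sum_(j <- t) (size t)%:R <= _).
  apply: ler_sum => j _; rewrite mulr1 -big_filter.
  rewrite big_const_seq count_predT iter_addr_0 -mulr_natr mul1r ler_nat size_filter.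
  exact: count_size.
by rewrite big_const_seq count_predT iter_addr_0 -[leLHS]mulr_natr expr2.
Qed.

End tuple_sums.

(** * The Hessian as a Gaussian process *)

Section hamiltonian_expansion.
Context {R : realType} (n : nat).
Local Notation N := n.+1.
Variables (beta eta : nat -> R) (x : seq nat -> R).
Hypothesis x_repeated : forall t, (2 <= size t)%N -> ~~ uniq t -> x t = 0.
Implicit Types (s : config N) (t : seq 'I_N) (u v : 'I_N -> R).

Definition weight (p : nat) : R := beta p / (N%:R `^ ((p%:R - 1) / 2)).

Definition spin_prod s t : R := \prod_(i <- t) spin R s i.

(** Lengths stop at N because longer tuples have repeated entries; the Hamiltonian is thus a finite
    sum. *)
Definition distinct_tuples : seq (seq 'I_N) :=
  [seq t <- [seq tval tp | p <- index_iota 2 N.+1, tp <- enum {: p.-tuple 'I_N}] | uniq t].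

Lemma distinct_tuplesP t : t \in distinct_tuples -> (2 <= size t)%N && uniq t.
Proof.
rewrite mem_filter => /andP[t_uniq /allpairsPdep[p [t' [p_in _ tE]]]].
by move: p_in; rewrite t_uniq andbT mem_index_iota tE size_tuple => /andP[].
Qed.

Lemma distinct_tuples_uniq : uniq distinct_tuples.
Proof.
apply: filter_uniq; apply: allpairs_uniq_dep; first exact: iota_uniq.
  by move=> p _; exact: enum_uniq.
move=> [p t] [p' t'] _ _ /= tt'.
have pp' : p = p' by rewrite -(size_tuple t) -(size_tuple t') tt'.
by subst p'; congr existT; exact: val_inj.
Qed.

Lemma big_distinct_tuples (F : seq 'I_N -> R) :
  \sum_(t <- distinct_tuples) F t =
  \sum_(2 <= p < N.+1) \sum_(t : p.-tuple 'I_N | uniq t) F t.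
Proof.
rewrite big_filter big_mkcond big_allpairs_dep /=; apply: eq_bigr => p _.
by rewrite big_enum /= -big_mkcond.
Qed.

Lemma p_spin_eq0 p s : (N < p)%N -> p_spin x p s = 0.
Proof.
move=> Np; apply: big1 => t _; rewrite x_repeated ?mul0r//.
  by rewrite size_map size_tuple (leq_trans _ Np).
rewrite (map_inj_uniq val_inj); apply/negP => t_uniq.
have := max_card (mem (t : seq 'I_N)).
by rewrite (card_uniqP t_uniq) size_tuple card_ord leqNgt Np.
Qed.

Lemma hamiltonianE s : hamiltonian beta eta x s =
  \sum_(t <- distinct_tuples) weight (size t) * x [seq val i | i <- t] * spin_prod s t
  + \sum_(i < N) eta i * spin R s i.
Proof.
congr (_ + _); apply: lim_near_cst => //.
near=> m; have Nm : (N.+1 <= m)%N by near: m; exact: nbhs_infty_ge.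
rewrite (@big_cat_nat _ _ _ N.+1)//= [X in _ + X]big_nat_cond [X in _ + X]big1; last first.
  by move=> p /andP[/andP[Np _] _]; rewrite p_spin_eq0// mulr0.
rewrite addr0 big_distinct_tuples big_nat [RHS]big_nat; apply: eq_bigr => p /andP[p2 _].
rewrite /p_spin mulr_sumr [RHS]big_mkcond /=; apply: eq_bigr => t _.
rewrite size_tuple mulrA; case: ifPn => // t_rep.
have -> : x [seq val i | i <- t] = 0; last by rewrite !(mul0r, mulr0).
apply: x_repeated.
  by rewrite size_map size_tuple.
by rewrite (map_inj_uniq val_inj).
Unshelve. all: by end_near. Qed.

Lemma spin_flip j s i : spin R (flip j s) i = (if i == j then -1 else 1) * spin R s i.
Proof.
rewrite /spin /flip ffunE; case: eqP => _; last by rewrite mul1r.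
by case: (s i); rewrite ?expr0 ?expr1 ?mulrNN ?mulr1.
Qed.

Lemma pderiv_spin_prod j s t : uniq t ->
  pderiv j (fun s => spin_prod s t) s = (j \in t)%:R * spin_prod s t.
Proof.
move=> t_uniq; rewrite /pderiv.
have -> : spin_prod (flip j s) t = (if j \in t then -1 else 1) * spin_prod s t.
  rewrite /spin_prod; case: ifPn => jt.
    rewrite (bigD1_seq j)//= spin_flip eqxx [in RHS](bigD1_seq j)//= mulrA; congr (_ * _).
    by apply: eq_bigr => i /negbTE ij; rewrite spin_flip ij mul1r.
  rewrite mul1r; apply: eq_big_seq => i it; rewrite spin_flip.
  by case: eqP => [ij|_]; [rewrite -ij it in jt|rewrite mul1r].
by case: (j \in t) => /=; field.
Qed.

Lemma mixed_hamiltonian i j s :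
  mixed (@hamiltonian R beta eta x N) i j s =
  if i == j then 0 else \sum_(t <- distinct_tuples)
    weight (size t) * x [seq val k | k <- t] * ((i \in t)%:R * (j \in t)%:R * spin_prod s t).
Proof.
rewrite /mixed; case: eqP => // /eqP ij.
have D1 r : pderiv j (@hamiltonian R beta eta x N) r =
    \sum_(t <- distinct_tuples)
      weight (size t) * x [seq val k | k <- t] * ((j \in t)%:R * spin_prod r t)
    + eta j * spin R r j.
  rewrite /pderiv !hamiltonianE opprD addrACA mulrDl; congr (_ + _).
    rewrite -sumrB mulr_suml; apply: eq_big_seq => t /distinct_tuplesP/andP[_ t_uniq].
    by rewrite -pderiv_spin_prod// /pderiv; ring.
  rewrite -sumrB (bigD1 j)//= spin_flip eqxx big1 => [|k /negbTE kj]; first by field.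
  by rewrite spin_flip kj mul1r subrr.
rewrite {1}/pderiv !D1 spin_flip eq_sym (negbTE ij) mul1r.
rewrite opprD addrACA subrr addr0 -sumrB mulr_suml.
apply: eq_big_seq => t /distinct_tuplesP/andP[_ t_uniq].
transitivity (weight (size t) * x [seq val k | k <- t] * ((j \in t)%:R *
   pderiv i (fun s => spin_prod s t) s)); first by rewrite /pderiv; ring.
by rewrite pderiv_spin_prod//; ring.
Qed.

Definition form_coef s u v t : R := weight (size t) * spin_prod s t * pairs u v t.

Lemma mixed_form s u v :
  \sum_i \sum_j u i * mixed (@hamiltonian R beta eta x N) i j s * v j =
  \sum_(t <- distinct_tuples) form_coef s u v t * x [seq val i | i <- t].
Proof.
transitivity (\sum_(t <- distinct_tuples) \sum_i \sum_j
   (weight (size t) * x [seq val i | i <- t] * spin_prod s t *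
   (if i == j then 0 else (i \in t)%:R * (j \in t)%:R * (u i * v j)))).
  rewrite [RHS]exchange_big /=; apply: eq_bigr => i _.
  rewrite [RHS]exchange_big /=; apply: eq_bigr => j _.
  rewrite mixed_hamiltonian; case: eqP => _.
    by rewrite mulr0 mul0r big1// => t _; rewrite mulr0.
  rewrite mulr_sumr mulr_suml; apply: eq_bigr => t _; ring.
apply: eq_big_seq => t /distinct_tuplesP/andP[_ t_uniq].
under eq_bigr do rewrite -mulr_sumr.
by rewrite -mulr_sumr /form_coef pairs_uniq//; ring.
Qed.

Lemma spin_prod_sqr s t : spin_prod s t ^+ 2 = 1.
Proof.
rewrite /spin_prod -prodrXl big1// => i _.
by rewrite /spin; case: (s i); rewrite ?expr1 ?expr0 ?sqrrN expr1n.
Qed.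

Lemma weight_sqr p : weight p ^+ 2 * N%:R ^+ p = beta p ^+ 2 * N%:R.
Proof.
rewrite /weight expr_div_n.
have N0 : 0 < N%:R :> R by rewrite ltr0n.
have e : (N%:R `^ ((p%:R - 1) / 2)) ^+ 2 * N%:R = N%:R ^+ p :> R.
  rewrite -powR_mulrn ?powR_ge0// -powRrM divfK//.
  rewrite -[X in _ * X]powRr1 ?ltW// -powRD ?subrK ?powR_mulrn ?ltW//.
  by apply/implyP => _; rewrite gt_eqF.
rewrite -e; have : (N%:R `^ ((p%:R - 1) / 2)) != 0 :> R by rewrite gt_eqF ?powR_gt0.
by move=> ?; field.
Qed.

Lemma form_coef_sqr s u v : \sum_(t <- distinct_tuples) form_coef s u v t ^+ 2 =
  \sum_(2 <= p < N.+1) weight p ^+ 2 * \sum_(t : p.-tuple 'I_N | uniq t) pairs u v t ^+ 2.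
Proof.
rewrite big_distinct_tuples; apply: eq_bigr => p _.
rewrite mulr_sumr; apply: eq_bigr => t _.
by rewrite /form_coef !exprMn spin_prod_sqr mulr1 size_tuple.
Qed.

(** The couplings live on tuples without repetition, where the cancellation fails; but the sum of
    squares only grows when extended to all tuples, where it holds. *)
Lemma form_variance s u v : \sum_i u i = 0 ->
  \sum_(t <- distinct_tuples) form_coef s u v t ^+ 2 <=
  (\sum_(2 <= p < N.+1) beta p ^+ 2 * p%:R ^+ 3) / N%:R *
  (\sum_i u i ^+ 2) * (\sum_i v i ^+ 2).
Proof.
move=> u0; rewrite form_coef_sqr 3!mulr_suml; apply: ler_sum => p _.
set U := \sum_i u i ^+ 2; set V := \sum_i v i ^+ 2.
have N0 : 0 < N%:R :> R by rewrite ltr0n.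
have := sum_position_pairs_sqr p v u0; rewrite -/U -/V => le1.
have le2 : \sum_(t : p.-tuple 'I_N | uniq t) pairs u v t ^+ 2 <=
           \sum_(t : p.-tuple 'I_N) position_pairs u v t ^+ 2.
  rewrite big_mkcond; apply: ler_sum => t _; case: ifPn => [t_uniq|_]; last exact: sqr_ge0.
  by rewrite pairs_tuple.
have le3 := le_trans (ler_wpM2l (exprn_ge0 2 (ltW N0)) le2) le1.
rewrite -(ler_pM2l (exprn_gt0 2 N0)) mulrCA.
apply: le_trans (ler_wpM2l (sqr_ge0 (weight p)) le3) _.
rewrite (_ : weight p ^+ 2 * _ = (weight p ^+ 2 * N%:R ^+ p) * (p%:R ^+ 3 * U * V)); last ring.
rewrite weight_sqr le_eqVlt; apply/orP; left; apply/eqP; field.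
by rewrite gt_eqF.
Qed.

(** Without centering the factor is p^4, but p <= N trades one p for N. This is exactly the factor
    by which [near_flat] lets (w N)^2 exceed kappa^2. *)
Lemma total_variance s :
  \sum_(t <- distinct_tuples) form_coef s (fun=> 1) (fun=> 1) t ^+ 2 <=
  (\sum_(2 <= p < N.+1) beta p ^+ 2 * p%:R ^+ 3) * N%:R ^+ 2.
Proof.
rewrite form_coef_sqr mulr_suml big_nat [leRHS]big_nat; apply: ler_sum => p /andP[_ pN].
have le1 : \sum_(t : p.-tuple 'I_N | uniq t) pairs (fun=> 1) (fun=> 1) t ^+ 2 <=
           p%:R ^+ 4 * N%:R ^+ p :> R.
  apply: le_trans (_ : \sum_(t : p.-tuple 'I_N) p%:R ^+ 4 <= _).
    rewrite big_mkcond; apply: ler_sum => t _; case: ifPn => _; last by rewrite exprn_ge0.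
    have /andP[h0 h1] := pairs_cst1 (R := R) (t : seq 'I_N).
    rewrite size_tuple in h1; rewrite (_ : p%:R ^+ 4 = (p%:R ^+ 2) ^+ 2); last by rewrite -exprM.
    by apply: lerXn2r; rewrite ?nnegrE// exprn_ge0.
  rewrite sumr_const card_tuple card_ord -[leLHS]mulr_natr natrX//.
apply: le_trans (ler_wpM2l (sqr_ge0 (weight p)) le1) _.
rewrite (_ : weight p ^+ 2 * _ = (weight p ^+ 2 * N%:R ^+ p) * p%:R ^+ 4); last ring.
rewrite weight_sqr (_ : beta p ^+ 2 * N%:R * p%:R ^+ 4 =
  (beta p ^+ 2 * p%:R ^+ 3 * N%:R) * p%:R); last ring.
rewrite (_ : beta p ^+ 2 * p%:R ^+ 3 * N%:R ^+ 2 =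
  (beta p ^+ 2 * p%:R ^+ 3 * N%:R) * N%:R); last ring.
apply: ler_wpM2l; last by rewrite ler_nat.
by apply: mulr_ge0 => //; apply: mulr_ge0 (sqr_ge0 _) _; rewrite exprn_ge0.
Qed.

End hamiltonian_expansion.

(** * The exceptional event *)

Section bad_event.
Context d (T : measurableType d) (R : realType) (P : probability T R).

Lemma prob_union_le (I : finType) (Q : pred I) (A : I -> set T) (b : R) :
  (forall i, measurable (A i)) -> (forall i, Q i -> (P (A i) <= b%:E)%E) ->
  measurable (\big[setU/set0]_(i | Q i) A i) /\
  (P (\big[setU/set0]_(i | Q i) A i) <= (\sum_(i | Q i) b)%:E)%E.
Proof.
move=> mA PA.
pose K (X : set T) (y : R) := measurable X /\ (P X <= y%:E)%E.
apply: (big_ind2 K).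
- by split; [exact: measurable0|rewrite measure0].
- move=> X1 y1 X2 y2 [m1 l1] [m2 l2]; split; first exact: measurableU.
  by rewrite EFinD; apply: le_trans (measureU2 _ m1 m2) _; exact: leeD.
- by move=> i Qi; split; [exact: mA|exact: PA].
Qed.

Variables (n : nat) (g : seq nat -> {RV P >-> R}) (beta eta : nat -> R).
Local Notation N := n.+1.
Hypothesis g_gauss : gaussian_couplings g.

Let H w : config N -> R := @hamiltonian R beta eta (fun t => g t w) N.

Definition gauss_form (s : config N) (u v : 'I_N -> R) (w : T) : R :=
  \sum_(t <- distinct_tuples n) form_coef beta s u v t * g [seq val i | i <- t] w.

Lemma gauss_formE s u v w :
  gauss_form s u v w = \sum_i \sum_j u i * mixed (H w) i j s * v j.
Proof.
rewrite mixed_form// => t t2 t_rep; have [_ _ g0] := g_gauss.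
exact: g0.
Qed.

(** Reindexing by sequences of naturals, the index type of the independent family. *)
Lemma gauss_formE_nat s u v w :
  gauss_form s u v w = \sum_(t <- [seq [seq val i | i <- t] | t <- distinct_tuples n])
    form_coef beta s u v [seq inord k | k <- t] * g t w.
Proof.
rewrite big_map; apply: eq_bigr => t _; congr (form_coef _ _ _ _ _ * _).
by rewrite mapK// => i; exact: inord_val.
Qed.

Lemma measurable_gauss_form s u v : measurable_fun setT (gauss_form s u v).
Proof. by apply: measurable_sum => t; exact: measurable_funM. Qed.

Lemma measurable_gauss_form_gt s u v c : measurable [set w | c < gauss_form s u v w].
Proof.
rewrite -[X in measurable X]setTI.
have := measurable_gauss_form s u v measurableT (measurable_itv `]c, +oo[).
rewrite (_ : _ @^-1` _ = [set w | c < gauss_form s u v w])//.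
by apply/seteqP; split => w /=; rewrite in_itv /= andbT.
Qed.

Lemma gauss_form_tail s u v c V : 0 <= c -> 0 < V ->
  \sum_(t <- distinct_tuples n) form_coef beta s u v t ^+ 2 <= V ->
  (P [set w | (c < gauss_form s u v w)%R] <= (expR (- (c ^+ 2 / (2 * V))))%:E)%E.
Proof.
move=> c0 V0 form_le.
have -> : [set w | c < gauss_form s u v w] =
  [set w | c < \sum_(t <- [seq [seq val i | i <- t] | t <- distinct_tuples n])
    form_coef beta s u v [seq inord k | k <- t] * g t w].
  by apply/seteqP; split => w /=; rewrite gauss_formE_nat.
apply: (gaussian_sum_tail g_gauss) => //.
- by rewrite map_inj_uniq ?distinct_tuples_uniq//; apply: inj_map; exact: val_inj.
- move=> t /mapP[t' /distinct_tuplesP t'P ->].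
  by rewrite size_map (map_inj_uniq val_inj).
- rewrite big_map; apply: le_trans form_le; rewrite le_eqVlt; apply/orP; left; apply/eqP.
  apply: eq_bigr => t _; congr (form_coef _ _ _ _ _ ^+ 2).
  by rewrite mapK// => i; exact: inord_val.
Qed.

Variables (beta0 delta : R).
Hypothesis beta0_gt0 : 0 < beta0.
Hypothesis deltaE : delta = 32 * beta0.
Hypothesis beta_le : \sum_(2 <= p < N.+1) beta p ^+ 2 * p%:R ^+ 3 <= 2 * beta0 ^+ 2.

Local Notation short := (@short R N).
Local Notation entry := (@entry R N).

Definition centered (x : 'I_N -> R) i : R := x i - (\sum_j x j) / N%:R.

Lemma centered_sum0 x : \sum_i centered x i = 0.
Proof.
by rewrite sumrB sumr_const card_ord -[_ *+ N]mulr_natr divfK ?subrr.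
Qed.

Lemma centered_sqr_le x : \sum_i centered x i ^+ 2 <= \sum_i x i ^+ 2.
Proof.
set m := (\sum_j x j) / N%:R.
have mN : \sum_j x j = m * N%:R by rewrite divfK.
have -> : \sum_i centered x i ^+ 2 = \sum_i x i ^+ 2 - m ^+ 2 * N%:R.
  transitivity (\sum_i (x i ^+ 2 - 2 * m * x i + m ^+ 2)).
    by apply: eq_bigr => i _; rewrite /centered -/m; ring.
  rewrite big_split /= sumrB -mulr_sumr mN sumr_const card_ord -[_ *+ N]mulr_natr; ring.
by rewrite lerBlDr lerDl mulr_ge0 ?sqr_ge0.
Qed.

(** The variance is at most (2 beta0^2 / N) (4 N) (4 N) = 32 beta0^2 N, and delta = 32 beta0 turns
    the exponent into 16 N. *)
Lemma short_form_tail s (z z' : int_vector N) : short z -> short z' ->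
  (P [set w | (delta * N%:R < gauss_form s (centered (entry z)) (entry z') w)%R]
     <= (expR (- 16 * N%:R))%:E)%E.
Proof.
move=> z_short z'_short; have N0 : 0 < N%:R :> R by rewrite ltr0n.
have := @gauss_form_tail s (centered (entry z)) (entry z') (delta * N%:R)
  (32 * beta0 ^+ 2 * N%:R).
rewrite (_ : - ((delta * N%:R) ^+ 2 / (2 * (32 * beta0 ^+ 2 * N%:R))) = - 16 * N%:R); last first.
  by rewrite deltaE; field; rewrite !gt_eqF.
apply.
- by rewrite deltaE !mulr_ge0// ltW.
- by rewrite !mulr_gt0// exprn_gt0.
apply: le_trans (form_variance _ _ _ (centered_sum0 _)) _.
have c_le : \sum_i centered (entry z) i ^+ 2 <= 4 * N%:R.
  exact: le_trans (centered_sqr_le _) z_short.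
have sq0 (u : 'I_N -> R) : 0 <= \sum_i u i ^+ 2.
  by apply: sumr_ge0 => i _; exact: sqr_ge0.
rewrite (_ : 32 * _ * _ = (2 * beta0 ^+ 2) / N%:R * (4 * N%:R) * (4 * N%:R)); last first.
  by field; rewrite gt_eqF.
have b0 : 0 <= \sum_(2 <= p < N.+1) beta p ^+ 2 * p%:R ^+ 3.
  by apply: sumr_ge0 => p _; apply: mulr_ge0 (sqr_ge0 _) _; rewrite exprn_ge0.
apply: ler_pM => //.
  by apply: mulr_ge0 => //; apply: mulr_ge0 => //; rewrite invr_ge0 ltW.
apply: ler_pM => //; first by apply: mulr_ge0 => //; rewrite invr_ge0 ltW.
by apply: ler_wpM2r => //; rewrite invr_ge0 ltW.
Qed.

Lemma total_form_tail s (e : bool) :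
  (P [set w | (2 * delta * N%:R * Num.sqrt N%:R < gauss_form s (fun=> (-1) ^+ e) (fun=> 1) w)%R]
     <= (expR (- 16 * N%:R))%:E)%E.
Proof.
have N0 : 0 < N%:R :> R by rewrite ltr0n.
have := @gauss_form_tail s (fun=> (-1) ^+ e) (fun=> 1) (2 * delta * N%:R * Num.sqrt N%:R)
  (2 * beta0 ^+ 2 * N%:R ^+ 2).
set E := - (_ / _) => tail.
apply: le_trans (tail _ _ _) _.
- by rewrite deltaE !mulr_ge0 ?sqrtr_ge0// ltW.
- by rewrite !mulr_gt0// exprn_gt0.
- apply: le_trans (_ : (\sum_(2 <= p < N.+1) beta p ^+ 2 * p%:R ^+ 3) * N%:R ^+ 2 <= _).
    apply: le_trans (total_variance beta s).
    rewrite le_eqVlt; apply/orP; left; apply/eqP; apply: eq_bigr => t _.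
    rewrite /form_coef !exprMn; congr (_ * _); rewrite /pairs !big_seq.
    transitivity (((-1) ^+ e * pairs (fun=> 1) (fun=> 1) t) ^+ 2 : R).
      congr (_ ^+ 2); rewrite /pairs big_seq mulr_sumr; apply: eq_bigr => j _.
      by rewrite !mulr1 mulr_sumr; apply: eq_bigr => i _; rewrite mulr1.
    by rewrite exprMn sqrr_sign mul1r /pairs big_seq.
  by apply: ler_wpM2r => //; exact: sqr_ge0.
rewrite lee_fin ler_expR /E deltaE 2!exprMn sqr_sqrtr ?ltW//.
rewrite (_ : _ / _ = 1024 * N%:R); last by field; rewrite !gt_eqF.
by move: N0; lra.
Qed.

(* Union bound: [2 ^ N * 64 ^ (2 N) = 2 ^ (13 N)] events of probability at most [exp (- 16 N)]. *)
Lemma flat_off_small_event : exists B : set T,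
  [/\ measurable B, (P B <= (3 * expR (- N%:R))%:E)%E &
  forall w, ~ B w -> forall s,
    near_flat (2 * delta) ((\sum_i \sum_j mixed (H w) i j s) / N%:R ^+ 2)
      (fun i j => mixed (H w) i j s)].
Proof.
have N0 : 0 < N%:R :> R by rewrite ltr0n.
pose I1 : finType := (config N * (int_vector N * int_vector N))%type.
pose I2 : finType := (config N * bool)%type.
pose Q (i : I1) := short i.2.1 && short i.2.2.
pose A1 (i : I1) := [set w | delta * N%:R <
  gauss_form i.1 (centered (entry i.2.1)) (entry i.2.2) w].
pose A2 (i : I2) := [set w | 2 * delta * N%:R * Num.sqrt N%:R <
  gauss_form i.1 (fun=> (-1) ^+ i.2) (fun=> 1) w].
have [m1 P1] := @prob_union_le I1 Q A1 (expR (- 16 * N%:R))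
  (fun i => measurable_gauss_form_gt _ _ _ _)
  (fun i => fun h => short_form_tail _ (proj1 (andP h)) (proj2 (andP h))).
have [m2 P2] := @prob_union_le I2 xpredT A2 (expR (- 16 * N%:R))
  (fun i => measurable_gauss_form_gt _ _ _ _) (fun i _ => total_form_tail _ _).
exists ((\big[setU/set0]_(i | Q i) A1 i) `|` (\big[setU/set0]_i A2 i)); split.
- exact: measurableU.
- apply: le_trans (measureU2 _ m1 m2) _; apply: le_trans (leeD P1 P2) _.
  rewrite -EFinD lee_fin.
  have e2 : 2 <= expR 1 :> R by have := expR_ge1Dx (1 : R); lra.
  have pow2 k : 2 ^+ k <= expR (k%:R : R).
    rewrite -[k%:R]mulr1 expRM_natl; apply: lerXn2r => //; rewrite nnegrE ?expR_ge0//.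
  have c1 : \sum_(i | Q i) expR (- 16 * N%:R) <= expR (- N%:R) :> R.
    rewrite -[X in \sum_(_ | _) X]mul1r -mulr_suml.
    rewrite (_ : \sum_(i | Q i) 1 = \sum_(s : config N)
       (\sum_(z | short z) 1) * (\sum_(z | short z) 1) :> R); last first.
      rewrite -(pair_big xpredT (fun zz : int_vector N * int_vector N => short zz.1 && short zz.2)
        (fun _ _ => 1))/=; apply: eq_bigr => s _.
      rewrite mulr_suml -(pair_big (fun z => short z) (fun z => short z) (fun _ _ => 1))/=.
      by apply: eq_bigr => z _; rewrite mul1r.
    rewrite sumr_const card_ffun card_bool card_ord -[_ *+ (2 ^ N)]mulr_natl natrX.
    have short_le := @short_vectors_count R N.
    apply: le_trans (_ : 2 ^+ (13 * N) * expR (- 16 * N%:R) <= _).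
      apply: ler_wpM2r; first exact: expR_ge0.
      rewrite (_ : 2 ^+ (13 * N) = 2 ^+ N * (64 ^+ N * 64 ^+ N) :> R); last first.
        by rewrite exprM -!exprMn; congr (_ ^+ _); rewrite -!natrM -natrX.
      apply: ler_wpM2l; first by rewrite exprn_ge0.
      by apply: ler_pM => //; apply: sumr_ge0.
    apply: le_trans (ler_wpM2r (expR_ge0 _) (pow2 _)) _.
    rewrite -expRD ler_expR natrM; lra.
  have c2 : \sum_(i : I2) expR (- 16 * N%:R) <= 2 * expR (- N%:R) :> R.
    rewrite sumr_const card_prod card_ffun !card_bool card_ord.
    rewrite -[_ *+ (2 ^ N * 2)]mulr_natl natrM natrX.
    rewrite mulrAC mulrC ler_wpM2l//.
    apply: le_trans (ler_wpM2r (expR_ge0 _) (pow2 _)) _.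
    by rewrite -expRD ler_expR; lra.
  by move: c1 c2; lra.
move=> w /not_orP[nB1 nB2] s.
have H1 z z' : short z -> short z' ->
    gauss_form s (centered (entry z)) (entry z') w <= delta * N%:R.
  move=> zs z's; rewrite leNgt; apply/negP => lt1; apply: nB1.
  by rewrite -bigcup_seq_cond; exists (s, (z, z')) => //=; rewrite mem_index_enum /Q /= zs z's.
have H2 (e : bool) : gauss_form s (fun=> (-1) ^+ e) (fun=> 1) w <= 2 * delta * N%:R * Num.sqrt N%:R.
  rewrite leNgt; apply/negP => lt1; apply: nB2.
  by rewrite -bigcup_seq; exists (s, e) => //=; rewrite mem_index_enum.
have delta0 : 0 <= delta by rewrite deltaE mulr_ge0// ltW.
have sumE (e : bool) : gauss_form s (fun=> (-1) ^+ e) (fun=> 1) w =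
    (-1) ^+ e * \sum_i \sum_j mixed (H w) i j s.
  rewrite gauss_formE mulr_sumr; apply: eq_bigr => i _; rewrite mulr_sumr.
  by apply: eq_bigr => j _; rewrite mulr1.
(* Removing the column means of the Hessian amounts to centering the left vector. *)
have centeredE (x y : 'I_N -> R) :
    \sum_i \sum_j x i * (mixed (H w) i j s - (\sum_l mixed (H w) l j s) / N%:R) * y j =
    \sum_i \sum_j centered x i * mixed (H w) i j s * y j.
  rewrite exchange_big [RHS]exchange_big /=; apply: eq_bigr => j _.
  rewrite -mulr_suml -[RHS]mulr_suml; congr (_ * _); rewrite /centered.
  transitivity (\sum_i x i * mixed (H w) i j s
      - (\sum_i x i) * ((\sum_l mixed (H w) l j s) / N%:R)).
    by rewrite [X in _ - X]mulr_suml -sumrB; apply: eq_bigr => i _; rewrite mulrBr.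
  by rewrite mulrCA [X in _ - X]mulr_suml -sumrB; apply: eq_bigr => i _; ring.
apply: near_flat_of_projection => //.
- by move=> i j; exact: mixedC.
- by have := H2 false; rewrite sumE expr0 mul1r.
- by have := H2 true; rewrite sumE expr1 mulN1r.
apply: bilinear_norm_le => // z z' zs z's.
by rewrite centeredE -gauss_formE; exact: H1.
Qed.

End bad_event.

(** * Measurability of the inverse gap *)

Section rational_test_functions.
Context {R : realType} {N : nat} (H : config N -> R).
Implicit Types (f : config N -> R) (F : nat -> config N -> R).

Lemma cvg_fin_sum (I : finType) (u : nat -> I -> R) (l : I -> R) :
  (forall i, u m i @[m --> \oo] --> l i) -> \sum_i u m i @[m --> \oo] --> \sum_i l i.
Proof.
move=> ul; elim: (index_enum I) => [|i r IH].
  by rewrite big_nil; under eq_cvg do rewrite big_nil; exact: cvg_cst.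
by rewrite big_cons; under eq_cvg do rewrite big_cons; apply: cvgD.
Qed.

Lemma cvg_mean F f : (forall s, F m s @[m --> \oo] --> f s) ->
  mean H (F m) @[m --> \oo] --> mean H f.
Proof. by move=> Ff; apply: cvg_fin_sum => s; apply: cvgMr; exact: Ff. Qed.

Lemma cvg_covar F f : (forall s, F m s @[m --> \oo] --> f s) ->
  covar H (F m) (F m) @[m --> \oo] --> covar H f f.
Proof.
move=> Ff; apply: cvgB; last by apply: cvgM; exact: cvg_mean.
by apply: (cvg_mean (F := fun m s => F m s * F m s)) => s; apply: cvgM.
Qed.

Lemma cvg_dirichlet F f : (forall s, F m s @[m --> \oo] --> f s) ->
  dirichlet H (F m) @[m --> \oo] --> dirichlet H f.
Proof.
move=> Ff; apply: cvg_fin_sum => j.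
apply: (cvg_mean (F := fun m s => cosh (cavity H j s) ^- 2 * pderiv j (F m) s ^+ 2)) => s.
have Dcvg : pderiv j (F m) s @[m --> \oo] --> pderiv j f s.
  by apply: cvgMl; apply: cvgB.
by apply: cvgMr; apply: cvgM.
Qed.

Lemma rational_approximation f : exists F : nat -> {ffun config N -> rat},
  forall s, ratr (F m s) @[m --> \oo] --> f s.
Proof.
have approx (m : nat) s : exists q : rat, ratr q \in `]f s - m.+1%:R^-1, f s[.
  by apply: rat_in_itvoo; rewrite gtrBl invr_gt0.
exists (fun m => [ffun s => sval (cid (approx m s))]) => s.
apply: (squeeze_cvgr (f := fun m => f s - m.+1%:R^-1) (h := fun=> f s)).
- near=> m; rewrite ffunE; case: cid => q /=; rewrite in_itv /= => /andP[h1 h2].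
  by rewrite !ltW.
- rewrite -[X in _ --> X]subr0; apply: cvgB; first exact: cvg_cst.
  exact: cvg_harmonic.
- exact: cvg_cst.
Unshelve. all: by end_near. Qed.

(** The strict inequality is an open condition on f, so rational test functions suffice and the
    event becomes a countable union. *)
Lemma lt_inverse_gap_rat (c : R) : (c%:E < inverse_gap H)%E <->
  exists q : {ffun config N -> rat},
    c * dirichlet H (fun s => ratr (q s)) < covar H (fun s => ratr (q s)) (fun s => ratr (q s)).
Proof.
split=> [|[q cD]]; last by apply/lt_inverse_gap; exists (fun s => ratr (q s)).
move/lt_inverse_gap => [f cD]; have [F Ff] := rational_approximation f.
have : covar H (fun s => ratr (F m s)) (fun s => ratr (F m s))
    - c * dirichlet H (fun s => ratr (F m s)) @[m --> \oo] --> covar H f f - c * dirichlet H f.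
  apply: cvgB; first exact: (cvg_covar (F := fun m s => ratr (F m s))).
  by apply: cvgMr; exact: (cvg_dirichlet (F := fun m s => ratr (F m s))).
move/cvgr_gt => /(_ 0); rewrite subr_gt0 => /(_ cD) [m _ /(_ m (leqnn m)) /=].
by rewrite subr_gt0; exists (F m).
Qed.

End rational_test_functions.

Section measurable_gap.
Context d (T : measurableType d) (R : realType) (N : nat).
Variable H : T -> config N -> R.
Hypothesis mH : forall s, measurable_fun setT (fun w => H w s).

Lemma measurable_inv_pos (h : T -> R) : (forall w, 0 < h w) ->
  measurable_fun setT h -> measurable_fun setT (fun w => (h w)^-1).
Proof.
move=> h0 mh; rewrite (_ : (fun _ => _) = fun w => h w `^ (-1)).
  exact: (measurableT_comp (measurable_powR (-1)) mh).
by apply/funext => w; rewrite powR_inv1// ltW.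
Qed.

Lemma measurable_mean (f : T -> config N -> R) :
  (forall s, measurable_fun setT (fun w => f w s)) ->
  measurable_fun setT (fun w => mean (H w) (f w)).
Proof.
move=> mf; apply: measurable_sum => s; apply: measurable_funM => //.
have mexp t : measurable_fun setT (fun w => expR (H w t)).
  exact: measurableT_comp (@measurable_expR R) (mH t).
apply: measurable_funM => //; apply: measurable_inv_pos.
  by move=> w; exact: partition_function_gt0.
by apply: measurable_sum => t.
Qed.

Lemma measurable_dirichlet (f : config N -> R) :
  measurable_fun setT (fun w => dirichlet (H w) f).
Proof.
apply: measurable_sum => j.
apply: (measurable_mean (f := fun w s => cosh (cavity (H w) j s) ^- 2 * pderiv j f s ^+ 2)) => s.
apply: measurable_funM => //; apply: measurable_inv_pos.
  by move=> w; rewrite exprn_gt0// /cosh divr_gt0// addr_gt0 ?expR_gt0.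
apply: measurable_realfun.measurable_funX; apply: measurable_funM => //.
have mcav : measurable_fun setT (fun w => cavity (H w) j s).
  by apply: measurable_funM => //; apply: measurable_funM => //; apply: measurable_funB.
apply: measurable_funD; apply: measurableT_comp => //.
exact: measurableT_comp.
Qed.

Lemma measurable_covar (f : config N -> R) :
  measurable_fun setT (fun w => covar (H w) f f).
Proof.
have mmean (h : config N -> R) : measurable_fun setT (fun w => mean (H w) h).
  by apply: (measurable_mean (f := fun w s => h s)).
by apply: measurable_funB => //; exact: measurable_funM.
Qed.

Lemma measurable_lt_inverse_gap (c : R) : measurable [set w | (c%:E < inverse_gap (H w))%E].
Proof.
pose E (q : {ffun config N -> rat}) := [set w |
  c * dirichlet (H w) (fun s => ratr (q s)) <
  covar (H w) (fun s => ratr (q s)) (fun s => ratr (q s))].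
rewrite (_ : [set w | _] = \bigcup_q E q); last first.
  apply/seteqP; split => w /=; first by move/lt_inverse_gap_rat => [q qE]; exists q.
  by move=> [q _ qE]; apply/lt_inverse_gap_rat; exists q.
apply: countable_bigcupT_measurable; first exact: countableP.
move=> q; rewrite -[E q]setTI.
have mcE : measurable_fun setT (fun w => c * dirichlet (H w) (fun s => ratr (q s)) <
    covar (H w) (fun s => ratr (q s)) (fun s => ratr (q s))).
  apply: measurable_fun_ltr; last exact: measurable_covar.
  by apply: measurable_funM => //; exact: measurable_dirichlet.
exact: (mcE measurableT [set true]).
Qed.

End measurable_gap.

(** * Conclusion *)

Lemma ln2_ge_half (R : realType) : 2^-1 <= ln 2 :> R.
Proof.
rewrite -[leLHS]expRK ler_ln ?posrE ?expR_gt0//.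
have := expR_ge1Dx (- 2^-1 : R); rewrite expRN => h.
have e0 := expR_gt0 (2^-1 : R).
rewrite -[expR _]invrK invf_ple ?posrE ?invr_gt0//; lra.
Qed.

(** As ln p >= 1/2 for p >= 2, each term is at most 2 c_p^2, and the sum of the c_p^2 is at most
    (max c_p) (sum c_p) <= beta0^2. *)
Lemma sum_beta_sqr_le (R : realType) (beta : nat -> R) (beta0 : R) (m : nat) :
  (forall p, (2 <= p)%N -> 0 <= beta p) ->
  (\sum_(2 <= p <oo) (Num.sqrt (p%:R ^+ 3 * ln p%:R) * beta p)%:E <= beta0%:E)%E ->
  \sum_(2 <= p < m) beta p ^+ 2 * p%:R ^+ 3 <= 2 * beta0 ^+ 2.
Proof.
move=> beta_ge0 series_le; pose c p := Num.sqrt (p%:R ^+ 3 * ln p%:R) * beta p.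
have c_ge0 p : (2 <= p)%N -> 0 <= c p by move=> p2; rewrite mulr_ge0 ?sqrtr_ge0 ?beta_ge0.
have sum_le : \sum_(2 <= p < m) c p <= beta0.
  rewrite -lee_fin -sumEFin; apply: le_trans series_le.
  by apply: nneseries_lim_ge => p p2 _; rewrite lee_fin c_ge0.
have c_le p : (2 <= p < m)%N -> c p <= beta0.
  move=> /andP[p2 pm]; apply: le_trans sum_le.
  rewrite (bigD1_seq p) ?iota_uniq ?mem_index_iota ?p2//= lerDl big_seq_cond.
  by apply: sumr_ge0 => q; rewrite mem_index_iota => /andP[/andP[q2 _] _]; exact: c_ge0.
apply: le_trans (_ : 2 * \sum_(2 <= p < m) c p * beta0 <= _).
  rewrite mulr_sumr big_nat [leRHS]big_nat; apply: ler_sum => p p2m.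
  have p2 : (2 <= p)%N by case/andP: p2m.
  apply: le_trans (_ : 2 * c p ^+ 2 <= _); last first.
    by rewrite expr2 ler_wpM2l// ler_wpM2l ?c_ge0// c_le.
  have lnp : 2^-1 <= ln p%:R :> R.
    by apply: le_trans (ln2_ge_half R) _; rewrite ler_ln ?posrE ?ltr0n ?ler_nat// (leq_trans _ p2).
  have p3 : 0 <= p%:R ^+ 3 :> R by rewrite exprn_ge0.
  rewrite /c exprMn sqr_sqrtr; last by rewrite mulr_ge0//; lra.
  rewrite (_ : 2 * (_ * _ * _) = (beta p ^+ 2 * p%:R ^+ 3) * (2 * ln p%:R)); last ring.
  by apply: ler_peMr; [exact: mulr_ge0 (sqr_ge0 _) p3|lra].
have beta0_ge0 : 0 <= beta0.
  apply: le_trans sum_le; rewrite big_nat; apply: sumr_ge0 => p /andP[p2 _]; exact: c_ge0.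
by rewrite -mulr_suml ler_wpM2l// expr2 ler_wpM2r.
Qed.

Theorem theorem1p1 (R : realType) (eps : R) (eps_gt0 : 0 < eps) :
  exists2 beta0 : R, 0 < beta0 &
  forall (beta eta : nat -> R),
    (forall p, (2 <= p)%N -> 0 <= beta p) ->
    (\sum_(2 <= p <oo) (beta p)%:E < +oo)%E ->
    (\sum_(2 <= p <oo) (Num.sqrt (p%:R ^+ 3 * ln p%:R) * beta p)%:E
       <= beta0%:E)%E ->
  exists c C : R, [/\ 0 < c, 0 < C &
  forall (d : measure_display) (T : measurableType d) (P : probability T R)
         (g : seq nat -> {RV P >-> R}),
    gaussian_couplings g ->
  forall N : nat, (0 < N)%N ->
    (P [set w | (1 + eps)%:E <
                inverse_gap (@hamiltonian R beta eta (fun t => g t w) N)]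
       <= (C * expR (- c * N%:R))%:E)%E].
Proof.
(* With kappa = 2 delta, 131 kappa = (262 / 400) eps / (1 + eps) <= 1 - 1 / (1 + eps), so the gap
   bound is at most 1 + eps; also kappa <= 1/200. *)
pose delta := eps / (400 * (1 + eps)).
have eps1_gt0 : 0 < 1 + eps by rewrite addr_gt0.
have pos400 : 0 < 400 * (1 + eps) by apply: mulr_gt0 eps1_gt0; rewrite ltr0n.
have delta_gt0 : 0 < delta := divr_gt0 eps_gt0 pos400.
have deltaE : delta * (1 + eps) = eps / 400 by rewrite /delta; field; rewrite gt_eqF.
have delta_lt : delta < 400^-1.
  by rewrite /delta (ltr_pdivrMr _ _ pos400); lra.
exists (delta / 32) => [|beta eta beta_ge0 _ series_le]; first by rewrite divr_gt0.
exists 1, 3; split => // d T P g g_gauss [//|n] _.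
have x_repeated w t : (2 <= size t)%N -> ~~ uniq t -> g t w = 0.
  by move=> t2 t_rep; have [_ _ ->] := g_gauss.
have beta0_gt0 : 0 < delta / 32 by rewrite divr_gt0.
have delta32 : delta = 32 * (delta / 32) by field.
have [B [mB PB flatB]] := flat_off_small_event eta g_gauss beta0_gt0 delta32
  (sum_beta_sqr_le n.+2 beta_ge0 series_le).
rewrite mulN1r; apply: le_trans PB; apply: le_measure; rewrite ?inE//.
  apply: measurable_lt_inverse_gap => s.
  under eq_fun do rewrite (hamiltonianE beta eta (x_repeated _)).
  apply: measurable_funD => //; apply: measurable_sum => t.
  by apply: measurable_funM => //; apply: measurable_funM.
move=> w /= gap_gt; apply: contrapT => /flatB flat.
move: gap_gt; apply/negP; rewrite -leNgt.
apply: le_trans (nearly_flat_inverse_gap_le _ _ flat) _ => //.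
  by apply/andP; split; [rewrite mulr_gt0|lra].
rewrite lee_fin -[leLHS]mul1r ler_pdivrMr; last by lra.
lra.
Qed.
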